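(* Consider problem $\min_{\mathbf x\in\mathbb R^n}F(\mathbf x)=\sum_{i=1}^I f_i(\mathbf x)$ where each $f_i$ is proper, closed and $L_i$-Lipschitz differentiable (possibly nonconvex) and $F$ is bounded from below. Let $\{(\mathbf x_i^k)_{i=1}^I\}_k$ be generated by ASY-SONATA (as in the context), where the step-size is obtained from a local sequence $\{\alpha^t\}_{t\in\mathbb N_0}$ with $\alpha^t\downarrow0$ and $\sum_t\alpha^t=\infty$ as follows: $\gamma^k=\alpha^{c_k}$, where $c_k$ is the number of iterations $t<k$ with $i^t=i^k$ (i.e., each agent draws successive elements of $\{\alpha^t\}$ according to its own activation count). For $\delta>0$ let $T_\delta$ be the first $k\in\mathbb N_0$ with $M_F(\mathbf x^k)\le\delta$. Then there is a constant $c>0$ such that $T_\delta\le\inf\{k\in\mathbb N_0:\sum_{t=0}^k\gamma^t\ge c/\delta\}$.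
   Context: Graph: $\mathcal G=(\mathcal V,\mathcal E)$, $\mathcal V=\{1,\dots,I\}$, strongly connected digraph without self-loops; $\mathcal N_i^{\rm in}=\{j:(j,i)\in\mathcal E\}$, $\mathcal N_i^{\rm out}=\{j:(i,j)\in\mathcal E\}$. Weight matrices $W=(w_{ij})$ (row-stochastic) and $A=(a_{ij})$ (column-stochastic) satisfy, for some $\bar m\in(0,1)$: diagonal entries $\ge\bar m$, entries $(i,j)$ with $(j,i)\in\mathcal E$ are $\ge\bar m$, all other entries $0$. Asynchrony model: $(i^k,\mathbf d^k)_{k\in\mathbb N_0}$, $i^k\in\mathcal V$, $\mathbf d^k=(d_j^k)_{j\in\mathcal N^{\rm in}_{i^k}}$, with every agent appearing among $i^k,\dots,i^{k+T-1}$ for all $k$ and $0\le d_j^k\le D$. ASY-SONATA: initialization $\mathbf x_i^0\in\mathbb R^n$, $\mathbf z_i^0=\nabla f_i(\mathbf x_i^0)$, $\tilde{\boldsymbol\rho}_{ij}^0=0$, $\tau_{ij}^{-1}=-D$, and $\boldsymbol\rho_{ij}^t=0$, $\mathbf v_i^t=0$ for $t=-D,\dots,0$. At iteration $k$ with $i=i^k$: (1) $\tau_{ij}^k=\max(\tau_{ij}^{k-1},k-d_j^k)$, $j\in\mathcal N_i^{\rm in}$; (2) $\mathbf v_i^{k+1}=\mathbf x_i^k-\gamma^k\mathbf z_i^k$; (3) $\mathbf x_i^{k+1}=w_{ii}\mathbf v_i^{k+1}+\sum_{j\in\mathcal N_i^{\rm in}}w_{ij}\mathbf v_j^{\tau_{ij}^k}$;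 (4) $\mathbf z_i^{k+1/2}=\mathbf z_i^k+\sum_{j\in\mathcal N_i^{\rm in}}(\boldsymbol\rho_{ij}^{\tau_{ij}^k}-\tilde{\boldsymbol\rho}_{ij}^k)+\nabla f_i(\mathbf x_i^{k+1})-\nabla f_i(\mathbf x_i^k)$; (5) $\mathbf z_i^{k+1}=a_{ii}\mathbf z_i^{k+1/2}$ and $\boldsymbol\rho_{ji}^{k+1}=\boldsymbol\rho_{ji}^k+a_{ji}\mathbf z_i^{k+1/2}$ for $j\in\mathcal N_i^{\rm out}$; (6) $\tilde{\boldsymbol\rho}_{ij}^{k+1}=\boldsymbol\rho_{ij}^{\tau_{ij}^k}$ for $j\in\mathcal N_i^{\rm in}$; (7) all other variables keep their values. Merit function: with $\mathbf x^k=[\mathbf x_1^{k\top},\dots,\mathbf x_I^{k\top}]^\top$ and $\bar{\mathbf x}^k=\frac1I\sum_i\mathbf x_i^k$, $M_F(\mathbf x^k)=\max\{\|\nabla F(\bar{\mathbf x}^k)\|^2,\|\mathbf x^k-\mathbf 1_I\otimes\bar{\mathbf x}^k\|^2\}$. *)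

(* Defs.v *)
From Stdlib Require Import Reals ZArith Relations Bool.
Open Scope R_scope.
Open Scope bool_scope.

(** Vectors of R^n are represented as functions [nat -> R]; only the
    coordinates [0..n-1] are ever observed (through [inner]/[norm]). *)
Definition vec := nat -> R.

Fixpoint rsum (m : nat) (f : nat -> R) : R :=
  match m with O => 0 | S m' => rsum m' f + f m' end.

Definition vzero : vec := fun _ => 0.
Definition vadd (u v : vec) : vec := fun l => u l + v l.
Definition vsub (u v : vec) : vec := fun l => u l - v l.
Definition vscale (a : R) (v : vec) : vec := fun l => a * v l.
Definition vsum (m : nat) (F : nat -> vec) : vec := fun l => rsum m (fun j => F j l).

Definition inner (n : nat) (u v : vec) : R := rsum n (fun l => u l * v l).
Definition sqnorm (n : nat) (v : vec) : R := inner n v v.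
Definition norm (n : nat) (v : vec) : R := sqrt (sqnorm n v).

Definition is_gradient (n : nat) (f : vec -> R) (g : vec -> vec) : Prop :=
  forall x eps, 0 < eps -> exists delta, 0 < delta /\
    forall h, norm n h < delta ->
      Rabs (f (vadd x h) - f x - inner n (g x) h) <= eps * norm n h.

(** State of ASY-SONATA at iteration k.
    sx a      = x_a^k,  sz a = z_a^k,  srt a j = rho~_{aj}^k,
    stau a j  = tau_{aj}^{k-1},
    sv t a    = v_a^t        (history, times t <= k; zero for t <= 0),
    srho t a b = rho_{ab}^t  (history, times t <= k; zero for t <= 0). *)
Record state := mkState {
  sx : nat -> vec;
  sz : nat -> vec;
  srt : nat -> nat -> vec;
  stau : nat -> nat -> Z;
  sv : Z -> nat -> vec;
  srho : Z -> nat -> nat -> vec }.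

Definition asy_init (D : nat) (g : nat -> vec -> vec) (x0 : nat -> vec) : state :=
  mkState x0 (fun i => g i (x0 i)) (fun _ _ => vzero) (fun _ _ => (- Z.of_nat D)%Z)
          (fun _ _ => vzero) (fun _ _ _ => vzero).

Definition asy_step (I : nat) (E : nat -> nat -> bool) (W A : nat -> nat -> R)
    (g : nat -> vec -> vec) (agent : nat -> nat) (d : nat -> nat -> nat)
    (gamma : nat -> R) (k : nat) (s : state) : state :=
  let i := agent k in
  let kz := Z.of_nat k in
  let tau' := fun a j => if Nat.eqb a i && E j i
                         then Z.max (stau s a j) (kz - Z.of_nat (d k j))%Z
                         else stau s a j in
  let vnew := vsub (sx s i) (vscale (gamma k) (sz s i)) in
  let xnew := vadd (vscale (W i i) vnew)
                   (vsum I (fun j => if E j i then vscale (W i j) (sv s (tau' i j) j)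
                                     else vzero)) in
  let zhalf := vadd (vadd (sz s i)
                          (vsum I (fun j => if E j i
                                            then vsub (srho s (tau' i j) i j) (srt s i j)
                                            else vzero)))
                    (vsub (g i xnew) (g i (sx s i))) in
  mkState
    (fun a => if Nat.eqb a i then xnew else sx s a)
    (fun a => if Nat.eqb a i then vscale (A i i) zhalf else sz s a)
    (fun a j => if Nat.eqb a i && E j i then srho s (tau' i j) i j else srt s a j)
    tau'
    (fun t a => if Z.eqb t (kz + 1)%Z
                then (if Nat.eqb a i then vnew else sv s kz a)
                else sv s t a)
    (fun t a b => if Z.eqb t (kz + 1)%Z
                  then (if Nat.eqb b i && E i a
                        then vadd (srho s kz a i) (vscale (A a i) zhalf)
                        else srho s kz a b)
                  else srho s t a b).

Fixpoint asy_run (I : nat) (E : nat -> nat -> bool) (W A : nat -> nat -> R)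
    (g : nat -> vec -> vec) (agent : nat -> nat) (d : nat -> nat -> nat)
    (gamma : nat -> R) (D : nat) (x0 : nat -> vec) (k : nat) : state :=
  match k with
  | O => asy_init D g x0
  | S k' => asy_step I E W A g agent d gamma k' (asy_run I E W A g agent d gamma D x0 k')
  end.

Fixpoint act_count (agent : nat -> nat) (k i : nat) : nat :=
  match k with
  | O => O
  | S k' => (act_count agent k' i + (if Nat.eqb (agent k') i then 1 else 0))%nat
  end.

Definition step_size (alpha : nat -> R) (agent : nat -> nat) (k : nat) : R :=
  alpha (act_count agent k (agent k)).

Definition xbar (I : nat) (x : nat -> vec) : vec := vscale (/ INR I) (vsum I x).

(** M_F(x) = max { ||grad F(xbar)||^2, ||x - 1 (x) xbar||^2 },
    grad F = sum_i grad f_i. *)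
Definition merit (n I : nat) (g : nat -> vec -> vec) (x : nat -> vec) : R :=
  let xb := xbar I x in
  Rmax (sqnorm n (vsum I (fun i => g i xb)))
       (rsum I (fun i => sqnorm n (vsub (x i) xb))).

(* Main.v *)
(** Coordinate by coordinate, the algorithm is a pair of linear systems with bounded
    delays, perturbed by the steps [gamma^k z] and by the gradient increments.

    The x-system is a delayed row-stochastic averaging. After a bounded time every value
    contains a fixed proportion of every other one, so the spread of the values contracts.
    The z-system redistributes mass (held by the agents or in transit) and conserves it.
    Since a fixed proportion of all mass reaches any given agent in bounded time, it
    contracts the l1 norm of states of total mass zero. Hence [z_i^k] is
    [xi_i^k * sum_j grad f_j (x_j^k)] up to an error [q_k], where [xi] is the trajectory
    started from the uniform distribution, while any two agents, and any future average of
    them, are within [r_k] of each other. Both errors are bounded by solutions of recursions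
    [e_(k+1) = rho e_k + c w_k], [w_k] being the size of the perturbation.

    For a horizon [K], let [y^k] be the value agent 0 would reach at time [K] if all steps
    from time [k] on were zero. Then [y^(k+1) = y^k - gamma^k beta z], with [beta] bounded
    away from 0 as long as [k] is not too close to [K]. Once the step sizes are small,
    [F (y^k) + omega r_k^2 + q_k^2] decreases by at least a multiple of
    [gamma^k |grad F (y^k)|^2 + r_k^2]. Therefore [sum_k gamma^k M_F (x^k)] is bounded,
    which is the claim. Each error is weighted by the step size of its own iteration, so
    the step sizes of different agents are never compared. *)

Require Import Defs.
From Stdlib Require Import Reals ZArith Relations Bool Lra Lia Classical FunctionalExtensionality.
Open Scope R_scope.

(** * Finite sums *)

Lemma rsum_ext m f f' :
  (forall i, (i < m)%nat -> f i = f' i) -> rsum m f = rsum m f'.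
Proof.
  induction m as [|m IH]; intros eq_terms; simpl; [reflexivity|].
  rewrite IH by (intros; apply eq_terms; lia).
  rewrite eq_terms by lia. reflexivity.
Qed.

Lemma rsum_plus m f f' : rsum m (fun i => f i + f' i) = rsum m f + rsum m f'.
Proof. induction m as [|m IH]; simpl; [ring | rewrite IH; ring]. Qed.

Lemma rsum_minus m f f' : rsum m (fun i => f i - f' i) = rsum m f - rsum m f'.
Proof. induction m as [|m IH]; simpl; [ring | rewrite IH; ring]. Qed.

Lemma rsum_scal m c f : rsum m (fun i => c * f i) = c * rsum m f.
Proof. induction m as [|m IH]; simpl; [ring | rewrite IH; ring]. Qed.

Lemma rsum_const m c : rsum m (fun _ => c) = INR m * c.
Proof.
  induction m as [|m IH]; [simpl; ring|].
  rewrite S_INR; simpl; rewrite IH; ring.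
Qed.

Lemma rsum_eq_0 m f : (forall i, (i < m)%nat -> f i = 0) -> rsum m f = 0.
Proof.
  intros zero_terms. rewrite (rsum_ext m f (fun _ => 0)) by assumption.
  rewrite rsum_const; ring.
Qed.

Lemma rsum_le m f f' :
  (forall i, (i < m)%nat -> f i <= f' i) -> rsum m f <= rsum m f'.
Proof.
  induction m as [|m IH]; intros le_terms; simpl; [lra|].
  apply Rplus_le_compat; [apply IH; intros; apply le_terms | apply le_terms]; lia.
Qed.

Lemma rsum_nonneg m f : (forall i, (i < m)%nat -> 0 <= f i) -> 0 <= rsum m f.
Proof.
  intros nonneg_terms. rewrite <- (rsum_eq_0 m (fun _ => 0)) by auto.
  apply rsum_le; assumption.
Qed.

Lemma rsum_term_le m f i :
  (forall j, (j < m)%nat -> 0 <= f j) -> (i < m)%nat -> f i <= rsum m f.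
Proof.
  induction m as [|m IH]; intros nonneg_terms i_lt; [lia|]; simpl.
  assert (0 <= f m) by (apply nonneg_terms; lia).
  assert (0 <= rsum m f) by (apply rsum_nonneg; intros; apply nonneg_terms; lia).
  destruct (Nat.eq_dec i m) as [->|]; [lra|].
  assert (f i <= rsum m f) by (apply IH; [intros; apply nonneg_terms|]; lia).
  lra.
Qed.

Lemma rsum_Rabs m f : Rabs (rsum m f) <= rsum m (fun i => Rabs (f i)).
Proof.
  induction m as [|m IH]; simpl; [rewrite Rabs_R0; lra|].
  eapply Rle_trans; [apply Rabs_triang | lra].
Qed.

Lemma rsum_indicator m i c :
  (i < m)%nat -> rsum m (fun j => if Nat.eqb j i then c else 0) = c.
Proof.
  induction m as [|m IH]; intros i_lt; [lia|]; simpl.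
  destruct (Nat.eqb_spec m i) as [->|].
  - rewrite rsum_eq_0; [ring|].
    intros j j_lt. destruct (Nat.eqb_spec j i); [lia|reflexivity].
  - rewrite IH by lia; ring.
Qed.

Lemma rsum_exchange m p f :
  rsum m (fun i => rsum p (fun j => f i j)) = rsum p (fun j => rsum m (fun i => f i j)).
Proof.
  induction m as [|m IH]; simpl.
  - symmetry; apply rsum_eq_0; auto.
  - rewrite IH, <- rsum_plus. reflexivity.
Qed.

Lemma rsum_add m p f : rsum (m + p) f = rsum m f + rsum p (fun i => f (m + i)%nat).
Proof.
  induction p as [|p IH]; [rewrite Nat.add_0_r; simpl; ring|].
  rewrite Nat.add_succ_r; simpl; rewrite IH; ring.
Qed.

Lemma rsum_window k a b f : (a <= b)%nat -> (b <= k)%nat ->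
  rsum k (fun t => if Nat.leb a t && Nat.ltb t b then f t else 0) = rsum b f - rsum a f.
Proof.
  intros a_le_b b_le_k.
  assert (rsum b f = rsum a f + rsum (b - a) (fun i => f (a + i)%nat))
    by (rewrite <- rsum_add; f_equal; lia).
  replace k with (a + ((b - a) + (k - b)))%nat by lia.
  rewrite !rsum_add, (rsum_eq_0 a), (rsum_eq_0 (k - b)), Rplus_0_l, Rplus_0_r.
  - rewrite (rsum_ext (b - a) _ (fun i => f (a + i)%nat)); [lra|].
    intros i i_lt. destruct (Nat.leb_spec a (a + i)); [|lia].
    destruct (Nat.ltb_spec (a + i) b); [reflexivity|lia].
  - intros i _. destruct (Nat.ltb_spec (a + (b - a + i)) b); [lia|].
    rewrite andb_false_r; reflexivity.
  - intros i i_lt. destruct (Nat.leb_spec a i); [lia|reflexivity].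
Qed.

Lemma rsum_if m (b : nat -> bool) f :
  rsum m f = rsum m (fun i => if b i then f i else 0) + rsum m (fun i => if b i then 0 else f i).
Proof. rewrite <- rsum_plus. apply rsum_ext. intros i _. destruct (b i); ring. Qed.

(** * Iterated time-varying maps *)

Fixpoint evolve {H : Type} (step : nat -> H -> H) (k m : nat) (h : H) : H :=
  match m with O => h | S m' => step (k + m')%nat (evolve step k m' h) end.

Lemma evolve_add {H} (step : nat -> H -> H) k m p h :
  evolve step k (m + p) h = evolve step (k + m) p (evolve step k m h).
Proof.
  induction p as [|p IH]; [rewrite Nat.add_0_r; reflexivity|].
  rewrite Nat.add_succ_r; simpl. rewrite IH, Nat.add_assoc. reflexivity.
Qed.

Lemma evolve_1 {H} (step : nat -> H -> H) k h : evolve step k 1 h = step k h.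
Proof. simpl. rewrite Nat.add_0_r. reflexivity. Qed.

Lemma evolve_S_first {H} (step : nat -> H -> H) k m h :
  evolve step k (S m) h = evolve step (S k) m (step k h).
Proof. rewrite <- Nat.add_1_l, evolve_add, evolve_1, Nat.add_1_r. reflexivity. Qed.

Lemma evolve_invariant {H} (step : nat -> H -> H) (P : nat -> H -> Prop) :
  (forall k h, P k h -> P (S k) (step k h)) ->
  forall k m h, P k h -> P (k + m)%nat (evolve step k m h).
Proof.
  intros P_step k m h P_h. induction m as [|m IH]; simpl.
  - rewrite Nat.add_0_r; exact P_h.
  - rewrite Nat.add_succ_r. apply P_step, IH.
Qed.

Lemma evolve_distr {H} (step : nat -> H -> H) (add : H -> H -> H) :
  (forall k h h', step k (add h h') = add (step k h) (step k h')) ->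
  forall k m h h', evolve step k m (add h h') = add (evolve step k m h) (evolve step k m h').
Proof.
  intros step_add k m h h'. induction m as [|m IH]; simpl; [reflexivity|].
  rewrite IH. apply step_add.
Qed.

(** * Perturbed contractions *)

Fixpoint discounted (rho c r0 : R) (e : nat -> R) (k : nat) : R :=
  match k with
  | O => c * r0
  | S k' => rho * discounted rho c r0 e k' + c * e k'
  end.

Lemma discounted_nonneg rho c r0 e k :
  0 <= rho -> 0 <= c -> 0 <= r0 -> (forall t, 0 <= e t) -> 0 <= discounted rho c r0 e k.
Proof.
  intros rho_nonneg c_nonneg r0_nonneg e_nonneg.
  induction k as [|k IH]; simpl; [|apply Rplus_le_le_0_compat];
    apply Rmult_le_pos; auto.
Qed.

Lemma root_in_unit_interval x B : 0 < x < 1 -> (0 < B)%nat ->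
  exists rho, 0 < rho < 1 /\ rho ^ B = x.
Proof.
  intros x_range B_pos.
  assert (0 < INR B) by (apply lt_0_INR; exact B_pos).
  assert (0 < / INR B) by (apply Rinv_0_lt_compat; assumption).
  exists (Rpower x (/ INR B)). split; [split|].
  - apply exp_pos.
  - rewrite <- exp_0. apply exp_increasing.
    assert (ln x < 0) by (rewrite <- ln_1; apply ln_increasing; lra). nra.
  - rewrite <- Rpower_pow by apply exp_pos.
    rewrite Rpower_mult, Rinv_l, Rpower_1 by lra. reflexivity.
Qed.

Lemma pow_le_1 x m : 0 <= x <= 1 -> x ^ m <= 1.
Proof. intros x_range. rewrite <- (pow1 m). apply pow_incr; assumption. Qed.

Definition input_to_state_stable {H : Type} (add : H -> H -> H) (step : nat -> H -> H)
    (ball : nat -> H -> R -> Prop) : Prop :=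
  exists rho c, 0 < rho < 1 /\ 0 < c /\
  forall (h w : nat -> H) (r0 : R) (e : nat -> R),
    0 <= r0 -> ball 0%nat (h O) r0 ->
    (forall k, 0 <= e k) ->
    (forall k, h (S k) = add (step k (h k)) (w k)) ->
    (forall k, ball (S k) (w k) (e k)) ->
    forall k, ball k (h k) (discounted rho c r0 e k).

Section PerturbedContraction.

Variables (H : Type) (add : H -> H -> H) (step : nat -> H -> H).
Variables (ball : nat -> H -> R -> Prop) (eta : R) (B : nat).
Hypothesis eta_range : 0 < eta < 1.
Hypothesis B_pos : (0 < B)%nat.
Hypothesis step_add : forall k h h', step k (add h h') = add (step k h) (step k h').
Hypothesis ball_mono : forall k h r r', r <= r' -> ball k h r -> ball k h r'.
Hypothesis ball_add :
  forall k h h' r r', ball k h r -> ball k h' r' -> ball k (add h h') (r + r').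
Hypothesis ball_step : forall k h r, ball k h r -> ball (S k) (step k h) r.
Hypothesis ball_contraction :
  forall k h r, 0 <= r -> ball k h r -> ball (k + B)%nat (evolve step k B h) ((1 - eta) * r).

Lemma ball_geometric rho : 0 < rho < 1 -> rho ^ B = 1 - eta ->
  forall m k h r, 0 <= r -> ball k h r ->
    ball (k + m)%nat (evolve step k m h) (rho ^ m * (/ (1 - eta) * r)).
Proof.
  intros rho_range rho_pow m.
  assert (0 < / (1 - eta)) by (apply Rinv_0_lt_compat; lra).
  induction m as [m IH] using lt_wf_ind. intros k h r r_nonneg h_ball.
  destruct (le_lt_dec B m) as [B_le|m_lt].
  - assert (0 <= (1 - eta) * r) by (apply Rmult_le_pos; lra).
    pose proof (IH (m - B)%nat ltac:(lia) (k + B)%nat (evolve step k B h)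
                   ((1 - eta) * r) ltac:(assumption) ltac:(auto)) as later_ball.
    rewrite <- evolve_add, <- Nat.add_assoc, <- rho_pow in later_ball.
    replace (B + (m - B))%nat with m in later_ball by lia.
    replace (rho ^ m) with (rho ^ (m - B) * rho ^ B) by (rewrite <- pow_add; f_equal; lia).
    rewrite <- rho_pow.
    replace (rho ^ (m - B) * rho ^ B * (/ rho ^ B * r))
      with (rho ^ (m - B) * (/ rho ^ B * (rho ^ B * r))) by ring.
    exact later_ball.
  - apply ball_mono with r; [|apply evolve_invariant with (P := fun k h => ball k h r); auto].
    assert (1 - eta <= rho ^ m).
    { replace B with (m + (B - m))%nat in rho_pow by lia. rewrite <- rho_pow, pow_add.
      pose proof (pow_le rho m ltac:(lra)). pose proof (pow_le_1 rho (B - m) ltac:(lra)). nra. }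
    replace r with ((1 - eta) * (/ (1 - eta) * r)) at 1 by (field; lra).
    apply Rmult_le_compat_r; [apply Rmult_le_pos; lra | assumption].
Qed.

(* The bounds [forall m, ball (k + m) (evolve step k m h) (rho ^ m * r)] play the role of
   an adapted norm: one step contracts them by [rho], so that the perturbations of a
   trajectory simply add up. *)
Lemma contraction_stable : input_to_state_stable add step ball.
Proof.
  destruct (root_in_unit_interval (1 - eta) B) as (rho & rho_range & rho_pow);
    [lra | exact B_pos |].
  exists rho, (/ (1 - eta)).
  split; [exact rho_range|]. split; [apply Rinv_0_lt_compat; lra|].
  intros h w r0 e r0_nonneg h0_ball e_nonneg h_S w_ball.
  assert (adapted : forall k m, ball (k + m)%nat (evolve step k m (h k))
                      (rho ^ m * discounted rho (/ (1 - eta)) r0 e k)).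
  { induction k as [|k IH]; intros m; simpl discounted.
    - apply ball_geometric; assumption.
    - rewrite h_S, evolve_distr, Rmult_plus_distr_l by exact step_add. apply ball_add.
      + rewrite <- evolve_S_first, Nat.add_succ_comm, <- Rmult_assoc,
          (Rmult_comm (rho ^ m)). apply (IH (S m)).
      + apply ball_geometric; auto. }
  intros k. specialize (adapted k O). simpl in adapted.
  rewrite Nat.add_0_r, Rmult_1_l in adapted. exact adapted.
Qed.

End PerturbedContraction.

(** * Propagation along a strongly connected graph *)

Record strongly_connected (V : nat) (E : nat -> nat -> bool) : Prop := {
  edge_range : forall i j, E i j = true -> (i < V)%nat /\ (j < V)%nat;
  path_exists : forall i j, (i < V)%nat -> (j < V)%nat ->
    clos_refl_trans nat (fun a b => E a b = true) i j }.

Definition recurrent (V T : nat) (agent : nat -> nat) : Prop :=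
  forall k i, (i < V)%nat -> exists t, (k <= t < k + T)%nat /\ agent t = i.

Lemma uniform_threshold V (P : nat -> nat -> Prop) :
  (forall i N M, (i < V)%nat -> (N <= M)%nat -> P N i -> P M i) ->
  (forall i, (i < V)%nat -> exists N, P N i) ->
  exists N, forall i, (i < V)%nat -> P N i.
Proof.
  intros P_mono P_ex. induction V as [|V IH]; [exists O; lia|].
  destruct IH as [N P_N].
  { intros i N M i_lt. apply P_mono; lia. }
  { intros; apply P_ex; lia. }
  destruct (P_ex V) as [M P_M]; [lia|].
  exists (N + M)%nat. intros i i_lt. destruct (Nat.eq_dec i V) as [->|].
  - apply (P_mono V M); [lia | lia | exact P_M].
  - apply (P_mono i N); [lia | lia | apply P_N; lia].
Qed.

Lemma pow_mult_le_trans x s p a b c : 0 <= x ->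
  x ^ s * a <= b -> x ^ p * b <= c -> x ^ (s + p) * a <= c.
Proof.
  intros x_nonneg ab bc. apply Rle_trans with (x ^ p * b); [|exact bc].
  rewrite pow_add, (Rmult_comm (x ^ s)), Rmult_assoc.
  apply Rmult_le_compat_l; [apply pow_le; exact x_nonneg | exact ab].
Qed.

Section PositiveSystem.

Variables (H : Type) (step : nat -> H -> H) (value : H -> nat -> R).
Variables (nonneg : nat -> H -> Prop).
Variables (V N0 : nat) (E : nat -> nat -> bool) (m : R).
Hypothesis graph : strongly_connected V E.
Hypothesis m_range : 0 < m < 1.
Hypothesis nonneg_step : forall k h, nonneg k h -> nonneg (S k) (step k h).
Hypothesis value_kept :
  forall k h a, nonneg k h -> (a < V)%nat -> m * value h a <= value (step k h) a.
Hypothesis edge_passes : forall j i, E j i = true -> forall k h, nonneg k h ->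
  exists s, (s <= N0)%nat /\ m ^ s * value h j <= value (evolve step k s h) i.

Definition reaches (N j i : nat) : Prop := forall k h, nonneg k h ->
  m ^ N * value h j <= value (evolve step k N h) i.

Lemma nonneg_evolve k s h : nonneg k h -> nonneg (k + s)%nat (evolve step k s h).
Proof. apply evolve_invariant, nonneg_step. Qed.

Lemma reaches_self s a : (a < V)%nat -> reaches s a a.
Proof.
  intros a_lt k h h_nonneg. induction s as [|s IH]; simpl; [lra|].
  apply Rle_trans with (m * value (evolve step k s h) a).
  - rewrite Rmult_assoc. apply Rmult_le_compat_l; lra.
  - apply value_kept; [apply nonneg_evolve|]; assumption.
Qed.

Lemma reaches_trans N M j i l : reaches N j i -> reaches M i l -> reaches (N + M) j l.
Proof.
  intros ji il k h h_nonneg. rewrite evolve_add.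
  eapply pow_mult_le_trans; [lra | apply ji | apply il, nonneg_evolve]; exact h_nonneg.
Qed.

Lemma reaches_mono j i N M : (i < V)%nat -> (N <= M)%nat -> reaches N j i -> reaches M j i.
Proof.
  intros i_lt N_le ji. replace M with (N + (M - N))%nat by lia.
  eapply reaches_trans; [exact ji | apply reaches_self; exact i_lt].
Qed.

Lemma reaches_edge j i : E j i = true -> reaches N0 j i.
Proof.
  intros ji k h h_nonneg. destruct (edge_range _ _ graph _ _ ji) as [_ i_lt].
  destruct (edge_passes j i ji k h h_nonneg) as (s & s_le & passed).
  replace N0 with (s + (N0 - s))%nat by lia. rewrite evolve_add.
  eapply pow_mult_le_trans; [lra | exact passed | apply reaches_self, nonneg_evolve; assumption].
Qed.

Lemma reaches_path j i : (j < V)%nat -> (i < V)%nat -> exists N, reaches N j i.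
Proof.
  intros j_lt i_lt.
  induction (path_exists _ _ graph j i j_lt i_lt) as [j i ji | j | j l i path_jl IHjl path_li IHli].
  - exists N0. apply reaches_edge, ji.
  - exists O. apply reaches_self, j_lt.
  - assert (l_lt : (l < V)%nat).
    { clear - graph i_lt path_li.
      induction path_li as [l i li | | ]; auto. apply (edge_range _ _ graph _ _ li). }
    destruct (IHjl j_lt l_lt) as [N jl]. destruct (IHli l_lt i_lt) as [M li].
    exists (N + M)%nat. eapply reaches_trans; eassumption.
Qed.

Lemma uniformly_reaches : exists N, forall j i, (j < V)%nat -> (i < V)%nat -> reaches N j i.
Proof.
  destruct (uniform_threshold V (fun N j => forall i, (i < V)%nat -> reaches N j i))
    as [N all_reach].
  - intros j N M _ N_le from_j i i_lt. apply reaches_mono with N; auto.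
  - intros j j_lt. apply uniform_threshold with (P := fun N i => reaches N j i).
    + intros i N M i_lt N_le. apply reaches_mono; assumption.
    + intros i i_lt. apply reaches_path; assumption.
  - exists N. intros; apply all_reach; assumption.
Qed.

End PositiveSystem.

(** * Configurations of a network *)

(* [own a] is the variable held by agent [a]; [post t a] is a message indexed by the
   iteration [t] at which it was written, [a] being its author in the averaging system and
   its addressee in the mass-splitting one. *)
Inductive cell : Type :=
  | own (a : nat)
  | post (t a : nat).

Definition config : Type := cell -> R.

Definition cadd (h h' : config) : config := fun c => h c + h' c.
Definition cscale (x : R) (h : config) : config := fun c => x * h c.
Definition cabs (h : config) : config := fun c => Rabs (h c).

Record linear_map (F : config -> config) : Prop := {
  linear_add : forall h h', F (cadd h h') = cadd (F h) (F h');
  linear_scale : forall x h, F (cscale x h) = cscale x (F h) }.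

Lemma evolve_linear step :
  (forall k, linear_map (step k)) -> forall k m, linear_map (evolve step k m).
Proof.
  intros step_linear k m. split.
  - apply evolve_distr. intros; apply step_linear.
  - intros x h. induction m as [|m IH]; simpl; [reflexivity|].
    rewrite IH. apply step_linear.
Qed.

Record weights (V : nat) (E : nat -> nat -> bool) (mbar : R) (W : nat -> nat -> R) : Prop := {
  diagonal_weight : forall i, (i < V)%nat -> mbar <= W i i;
  edge_weight : forall i j,
    (i < V)%nat -> (j < V)%nat -> E j i = true -> mbar <= W i j;
  off_edge_weight : forall i j,
    (i < V)%nat -> (j < V)%nat -> i <> j -> E j i = false -> W i j = 0 }.

Lemma weights_nonneg V E mbar W i j :
  0 <= mbar -> weights V E mbar W -> (i < V)%nat -> (j < V)%nat -> 0 <= W i j.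
Proof.
  intros mbar_nonneg [diag edge off] i_lt j_lt.
  destruct (Nat.eq_dec i j) as [->|ij]; [specialize (diag j j_lt); lra|].
  destruct (E j i) eqn:ji.
  - specialize (edge i j i_lt j_lt ji); lra.
  - rewrite off by assumption; lra.
Qed.

Lemma weights_average V E mbar W i x u :
  (forall j, E j j = false) -> weights V E mbar W -> (i < V)%nat ->
  rsum V (fun j => W i j * (if E j i then u j else x))
  = W i i * x + rsum V (fun j => if E j i then W i j * u j else 0).
Proof.
  intros no_self_loop W_weights i_lt.
  rewrite <- (rsum_indicator V i (W i i * x) i_lt), <- rsum_plus.
  apply rsum_ext. intros j j_lt. destruct (Nat.eqb_spec j i) as [->|ji].
  - rewrite no_self_loop. ring.
  - destruct (E j i) eqn:edge; [ring|].
    rewrite (off_edge_weight _ _ _ _ W_weights) by auto. ring.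
Qed.

(** * Delayed averaging *)

Section Averaging.

Variables (V T D : nat) (E : nat -> nat -> bool) (W : nat -> nat -> R) (mbar : R).
Variables (agent : nat -> nat) (src : nat -> nat -> nat).
Hypothesis graph : strongly_connected V E.
Hypothesis no_self_loop : forall i, E i i = false.
Hypothesis mbar_range : 0 < mbar < 1.
Hypothesis W_weights : weights V E mbar W.
Hypothesis W_row_sum : forall i, (i < V)%nat -> rsum V (fun j => W i j) = 1.
Hypothesis agent_lt : forall k, (agent k < V)%nat.
Hypothesis agent_recurrent : recurrent V T agent.
Hypothesis src_window : forall k j, E j (agent k) = true -> (k - D <= src k j <= k)%nat.

(* For [j] not an in-neighbour, the cell read is irrelevant unless [j] is the active agent
   itself, since the weight vanishes. *)
Definition source (k j : nat) : cell :=
  if E j (agent k) then post (src k j) j else own (agent k).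

Definition avg_step (k : nat) (h : config) : config := fun c =>
  match c with
  | own a => if Nat.eqb a (agent k) then rsum V (fun j => W a j * h (source k j)) else h (own a)
  | post t a =>
      if Nat.eqb t (S k) then (if Nat.eqb a (agent k) then h (own a) else h (post k a))
      else h (post t a)
  end.

Definition visible (k : nat) (c : cell) : Prop :=
  match c with
  | own a => (a < V)%nat
  | post t a => (a < V)%nat /\ (k - D <= t <= k)%nat
  end.

Definition avg_nonneg (k : nat) (h : config) : Prop := forall c, visible k c -> 0 <= h c.

Definition spread (k : nat) (h : config) (r : R) : Prop :=
  exists lo, forall c, visible k c -> lo <= h c <= lo + r.

Lemma avg_step_linear k : linear_map (avg_step k).
Proof.
  split; intros; apply functional_extensionality; intros [a|t a]; unfold cadd, cscale; simpl.
  - destruct (Nat.eqb a (agent k)); [|reflexivity].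
    rewrite <- rsum_plus. apply rsum_ext. intros; ring.
  - destruct (Nat.eqb t (S k)), (Nat.eqb a (agent k)); reflexivity.
  - destruct (Nat.eqb a (agent k)); [|reflexivity].
    rewrite <- rsum_scal. apply rsum_ext. intros; ring.
  - destruct (Nat.eqb t (S k)), (Nat.eqb a (agent k)); reflexivity.
Qed.

Lemma avg_evolve_linear k m : linear_map (evolve avg_step k m).
Proof. apply evolve_linear, avg_step_linear. Qed.

Lemma avg_evolve_ones k m : evolve avg_step k m (fun _ => 1) = fun _ => 1.
Proof.
  induction m as [|m IH]; simpl; [reflexivity|]. rewrite IH.
  apply functional_extensionality; intros [a|t a]; simpl.
  - destruct (Nat.eqb_spec a (agent (k + m))) as [->|]; [|reflexivity].
    transitivity (rsum V (fun j => W (agent (k + m)) j)); [|apply W_row_sum, agent_lt].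
    apply rsum_ext. intros; apply Rmult_1_r.
  - destruct (Nat.eqb t (S (k + m))), (Nat.eqb a (agent (k + m))); reflexivity.
Qed.

Lemma avg_evolve_affine k m x y h :
  evolve avg_step k m (fun c => x * h c + y) = fun c => x * evolve avg_step k m h c + y.
Proof.
  replace (fun c => x * h c + y) with (cadd (cscale x h) (cscale y (fun _ => 1))).
  - rewrite (linear_add _ (avg_evolve_linear k m)), !(linear_scale _ (avg_evolve_linear k m)).
    rewrite avg_evolve_ones.
    apply functional_extensionality; intros c. unfold cadd, cscale; ring.
  - apply functional_extensionality; intros c. unfold cadd, cscale; ring.
Qed.

Lemma source_visible k j : (j < V)%nat -> visible k (source k j).
Proof.
  intros j_lt. unfold source. destruct (E j (agent k)) eqn:edge; simpl; auto.
Qed.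

Lemma avg_step_nonneg k h : avg_nonneg k h -> avg_nonneg (S k) (avg_step k h).
Proof.
  intros h_nonneg [a|t a] c_visible; cbn [avg_step].
  - destruct (Nat.eqb a (agent k)); [|apply h_nonneg; exact c_visible].
    apply rsum_nonneg. intros j j_lt. apply Rmult_le_pos.
    + apply (weights_nonneg V E mbar); auto; lra.
    + apply h_nonneg, source_visible, j_lt.
  - destruct c_visible as [a_lt t_range].
    destruct (Nat.eqb_spec t (S k)); [destruct (Nat.eqb a (agent k))|];
      apply h_nonneg; [exact a_lt | split; lia | split; lia].
Qed.

Lemma avg_evolve_nonneg k s h : avg_nonneg k h -> avg_nonneg (k + s) (evolve avg_step k s h).
Proof. apply evolve_invariant, avg_step_nonneg. Qed.

Lemma avg_step_source k h j : avg_nonneg k h -> (j < V)%nat -> mbar <= W (agent k) j ->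
  mbar * h (source k j) <= avg_step k h (own (agent k)).
Proof.
  intros h_nonneg j_lt weight_ge. simpl. rewrite Nat.eqb_refl.
  apply Rle_trans with (W (agent k) j * h (source k j)).
  - apply Rmult_le_compat_r; [apply h_nonneg, source_visible, j_lt | exact weight_ge].
  - apply (rsum_term_le V (fun i => W (agent k) i * h (source k i))); [|exact j_lt].
    intros i i_lt. apply Rmult_le_pos.
    + apply (weights_nonneg V E mbar); auto; lra.
    + apply h_nonneg, source_visible, i_lt.
Qed.

Lemma avg_step_keeps k h a : avg_nonneg k h -> (a < V)%nat ->
  mbar * h (own a) <= avg_step k h (own a).
Proof.
  intros h_nonneg a_lt. destruct (Nat.eq_dec a (agent k)) as [->|inactive].
  - replace (own (agent k)) with (source k (agent k)) at 1.
    + apply avg_step_source; auto. eapply diagonal_weight; eauto.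
    + unfold source. rewrite no_self_loop. reflexivity.
  - simpl. destruct (Nat.eqb_spec a (agent k)); [contradiction|].
    specialize (h_nonneg (own a) a_lt). nra.
Qed.

Lemma avg_keeps k s h a : avg_nonneg k h -> (a < V)%nat ->
  mbar ^ s * h (own a) <= evolve avg_step k s h (own a).
Proof.
  intros h_nonneg a_lt.
  apply (reaches_self _ avg_step (fun h a => h (own a)) avg_nonneg V mbar); auto.
  - apply avg_step_nonneg.
  - intros; apply avg_step_keeps; assumption.
Qed.

Lemma avg_posts k u s t h j : avg_nonneg k h -> (j < V)%nat -> agent u = j ->
  (k <= u < t)%nat -> (t <= k + s)%nat ->
  mbar ^ s * h (own j) <= evolve avg_step k s h (post t j).
Proof.
  intros h_nonneg j_lt active u_range. revert t u_range.
  assert (0 <= h (own j)) by (apply (h_nonneg (own j)), j_lt).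
  induction s as [|s IH]; intros t u_range t_le; [lia|].
  assert (mbar ^ S s * h (own j) <= mbar ^ s * h (own j)).
  { apply Rmult_le_compat_r; [assumption|].
    pose proof (pow_le mbar s ltac:(lra)). simpl; nra. }
  simpl evolve. unfold avg_step at 1.
  destruct (Nat.eqb_spec t (S (k + s))) as [->|].
  - destruct (Nat.eqb_spec j (agent (k + s))) as [|inactive].
    + eapply Rle_trans; [eassumption|]. apply avg_keeps; assumption.
    + assert (u <> (k + s)%nat) by congruence.
      eapply Rle_trans; [eassumption|]. apply IH; lia.
  - eapply Rle_trans; [eassumption|]. apply IH; lia.
Qed.

Lemma avg_edge_passes j i : E j i = true -> forall k h, avg_nonneg k h ->
  exists s, (s <= 2 * T + D)%nat /\
    mbar ^ s * h (own j) <= evolve avg_step k s h (own i).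
Proof.
  intros edge k h h_nonneg. destruct (edge_range _ _ graph _ _ edge) as [j_lt i_lt].
  destruct (agent_recurrent k j j_lt) as (u & u_range & u_active).
  destruct (agent_recurrent (k + T + D)%nat i i_lt) as (t & t_range & t_active).
  exists (S (t - k)). split; [lia|]. subst i.
  simpl evolve. replace (k + (t - k))%nat with t by lia.
  apply Rle_trans with (mbar * evolve avg_step k (t - k) h (source t j)).
  - simpl pow. rewrite Rmult_assoc. apply Rmult_le_compat_l; [lra|].
    unfold source. rewrite edge. pose proof (src_window t j edge).
    apply avg_posts with u; auto; lia.
  - apply avg_step_source; [|exact j_lt|eapply edge_weight; eauto].
    replace t with (k + (t - k))%nat at 1 by lia. apply avg_evolve_nonneg, h_nonneg.
Qed.

Lemma avg_positivity : exists N, (0 < N)%nat /\ forall k h j, (j < V)%nat ->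
  avg_nonneg k h -> forall c, visible (k + N) c ->
  mbar ^ N * h (own j) <= evolve avg_step k N h c.
Proof.
  destruct (uniformly_reaches _ avg_step (fun h a => h (own a)) avg_nonneg V (2 * T + D) E mbar)
    as [N all_reach]; auto using avg_step_nonneg, avg_step_keeps, avg_edge_passes.
  exists (N + (T + D))%nat. split.
  { destruct (agent_recurrent O (agent O) (agent_lt O)) as (t & t_range & _). lia. }
  intros k h j j_lt h_nonneg c c_visible. rewrite evolve_add.
  assert (later_nonneg : avg_nonneg (k + N) (evolve avg_step k N h))
    by (apply avg_evolve_nonneg, h_nonneg).
  destruct c as [i|t i].
  - apply pow_mult_le_trans with (evolve avg_step k N h (own i)); [lra | |].
    + apply all_reach; assumption.
    + apply avg_keeps; assumption.
  - destruct c_visible as [i_lt t_range].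
    apply pow_mult_le_trans with (evolve avg_step k N h (own i)); [lra | |].
    + apply all_reach; assumption.
    + destruct (agent_recurrent (k + N)%nat i i_lt) as (u & u_range & u_active).
      apply avg_posts with u; auto; lia.
Qed.

Lemma avg_evolve_range k s h lo hi :
  (forall c, visible k c -> lo <= h c <= hi) ->
  forall c, visible (k + s) c -> lo <= evolve avg_step k s h c <= hi.
Proof.
  intros h_range c c_visible.
  pose proof (avg_evolve_nonneg k s (fun c => 1 * h c + - lo)) as above.
  pose proof (avg_evolve_nonneg k s (fun c => -1 * h c + hi)) as below.
  rewrite avg_evolve_affine in above, below.
  assert (0 <= 1 * evolve avg_step k s h c + - lo)
    by (apply above; [intros c' c'_visible; specialize (h_range c' c'_visible); lra | assumption]).
  assert (0 <= -1 * evolve avg_step k s h c + hi)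
    by (apply below; [intros c' c'_visible; specialize (h_range c' c'_visible); lra | assumption]).
  lra.
Qed.

(* Every cell receives a fixed proportion of the value of agent 0, seen from both ends of
   the range. *)
Lemma spread_contraction : (0 < V)%nat -> exists N, (0 < N)%nat /\
  forall k h r, spread k h r ->
    spread (k + N) (evolve avg_step k N h) ((1 - mbar ^ N) * r).
Proof.
  intros V_pos. destruct avg_positivity as (N & N_pos & positivity).
  exists N. split; [exact N_pos|]. intros k h r [lo h_range].
  exists (lo + mbar ^ N * (h (own O) - lo)). intros c c_visible.
  pose proof (positivity k (fun c => 1 * h c + - lo) O V_pos) as above.
  pose proof (positivity k (fun c => -1 * h c + (lo + r)) O V_pos) as below.
  rewrite avg_evolve_affine in above, below.
  specialize (above ltac:(intros c' c'_visible; specialize (h_range c' c'_visible); lra)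
                c c_visible).
  specialize (below ltac:(intros c' c'_visible; specialize (h_range c' c'_visible); lra)
                c c_visible).
  simpl in above, below. lra.
Qed.

Lemma spread_mono k h r r' : r <= r' -> spread k h r -> spread k h r'.
Proof.
  intros r_le [lo h_range]. exists lo. intros c c_visible.
  specialize (h_range c c_visible); lra.
Qed.

Lemma avg_stable : (0 < V)%nat -> input_to_state_stable cadd avg_step spread.
Proof.
  intros V_pos. destruct (spread_contraction V_pos) as (N & N_pos & contraction).
  apply (contraction_stable config cadd avg_step spread (mbar ^ N) N); auto.
  - split; [apply pow_lt; lra|]. apply pow_lt_1_compat; [lra | lia].
  - intros k. apply linear_add, avg_step_linear.
  - apply spread_mono.
  - intros k h h' r r' [lo h_range] [lo' h'_range]. exists (lo + lo').
    intros c c_visible. specialize (h_range c c_visible). specialize (h'_range c c_visible).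
    unfold cadd; lra.
  - intros k h r [lo h_range]. exists lo.
    rewrite <- evolve_1, <- Nat.add_1_r. apply avg_evolve_range, h_range.
Qed.

Lemma avg_evolve_near k s h r a c : spread k h r -> (a < V)%nat -> visible k c ->
  Rabs (evolve avg_step k s h (own a) - h c) <= r.
Proof.
  intros [lo h_range] a_lt c_visible.
  pose proof (avg_evolve_range k s h lo (lo + r) h_range (own a) a_lt).
  specialize (h_range c c_visible). apply Rabs_le; lra.
Qed.

Lemma spread_scale k h x : (forall c, visible k c -> 0 <= h c <= 1) ->
  spread k (cscale x h) (Rabs x).
Proof.
  intros h_range. exists (Rmin x 0). intros c c_visible.
  specialize (h_range c c_visible). unfold cscale.
  destruct (Rle_dec 0 x).
  - rewrite Rmin_right, Rabs_pos_eq by lra. nra.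
  - rewrite Rmin_left, Rabs_left by lra. nra.
Qed.

End Averaging.

(** * Delayed mass splitting *)

Section MassSplitting.

Variables (V T D : nat) (E : nat -> nat -> bool) (A : nat -> nat -> R) (mbar : R).
Variables (agent : nat -> nat) (rcv : nat -> nat -> bool).
Hypothesis V_pos : (0 < V)%nat.
Hypothesis graph : strongly_connected V E.
Hypothesis no_self_loop : forall i, E i i = false.
Hypothesis mbar_range : 0 < mbar < 1.
Hypothesis A_weights : weights V E mbar A.
Hypothesis A_column_sum : forall j, (j < V)%nat -> rsum V (fun i => A i j) = 1.
Hypothesis agent_lt : forall k, (agent k < V)%nat.
Hypothesis agent_recurrent : recurrent V T agent.
Hypothesis rcv_old : forall k t, (t + D < k)%nat -> rcv k t = true.

(* [post t a] is the mass sent to [a] at iteration [t] and not yet received, and [rcv k t]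
   tells whether the agent active at iteration [k] receives what was sent at iteration [t]. *)
Definition gathered (k : nat) (h : config) : R :=
  h (own (agent k)) + rsum k (fun t => if rcv k t then h (post t (agent k)) else 0).

Definition split_step (k : nat) (h : config) : config := fun c =>
  match c with
  | own a => if Nat.eqb a (agent k) then A a a * gathered k h else h (own a)
  | post t a =>
      if Nat.eqb t k then (if E (agent k) a then A a (agent k) * gathered k h else 0)
      else if Nat.eqb a (agent k) && rcv k t then 0 else h (post t a)
  end.

Definition split_unit (k : nat) : config := fun c =>
  match c with
  | own a => if Nat.eqb a (agent k) then A a a else 0
  | post t a => if Nat.eqb t k && E (agent k) a then A a (agent k) else 0
  end.

Definition live (k : nat) (c : cell) : Prop :=
  match c with
  | own a => (a < V)%nat
  | post t a => (a < V)%nat /\ (t < k)%nat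
  end.

Definition mass_nonneg (k : nat) (h : config) : Prop := forall c, live k c -> 0 <= h c.

Definition holding (k : nat) (h : config) (a : nat) : R :=
  h (own a) + rsum k (fun t => h (post t a)).

Definition mass (k : nat) (h : config) : R := rsum V (holding k h).

Definition balanced (k : nat) (h : config) (r : R) : Prop :=
  mass k h = 0 /\ mass k (cabs h) <= r.

Lemma A_nonneg i j : (i < V)%nat -> (j < V)%nat -> 0 <= A i j.
Proof. apply (weights_nonneg V E mbar A); [lra | exact A_weights]. Qed.

Lemma gathered_add k h h' : gathered k (cadd h h') = gathered k h + gathered k h'.
Proof.
  unfold gathered, cadd.
  rewrite (rsum_ext k _ (fun t => (if rcv k t then h (post t (agent k)) else 0)
                                  + (if rcv k t then h' (post t (agent k)) else 0))).
  - rewrite rsum_plus; ring.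
  - intros t _. destruct (rcv k t); ring.
Qed.

Lemma gathered_scale k x h : gathered k (cscale x h) = x * gathered k h.
Proof.
  unfold gathered, cscale.
  rewrite (rsum_ext k _ (fun t => x * (if rcv k t then h (post t (agent k)) else 0))).
  - rewrite rsum_scal; ring.
  - intros t _. destruct (rcv k t); ring.
Qed.

Lemma split_step_linear k : linear_map (split_step k).
Proof.
  split; intros; apply functional_extensionality; intros [a|t a]; unfold split_step;
    rewrite ?gathered_add, ?gathered_scale; unfold cadd, cscale.
  1, 3: destruct (Nat.eqb a (agent k)); ring.
  all: destruct (Nat.eqb t k); [destruct (E (agent k) a)|destruct (_ && _)]; ring.
Qed.

Lemma mass_add k h h' : mass k (cadd h h') = mass k h + mass k h'.
Proof.
  unfold mass. rewrite <- rsum_plus. apply rsum_ext. intros a _.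
  unfold holding, cadd. rewrite rsum_plus; ring.
Qed.

Lemma mass_scale k x h : mass k (cscale x h) = x * mass k h.
Proof.
  unfold mass. rewrite <- rsum_scal. apply rsum_ext. intros a _.
  unfold holding, cscale. rewrite rsum_scal; ring.
Qed.

Lemma mass_mono k h h' : (forall c, live k c -> h c <= h' c) -> mass k h <= mass k h'.
Proof.
  intros h_le. apply rsum_le. intros a a_lt. unfold holding.
  apply Rplus_le_compat; [apply h_le; exact a_lt|].
  apply rsum_le. intros t t_lt. apply h_le; split; assumption.
Qed.

Lemma own_le_mass k h a : mass_nonneg k h -> (a < V)%nat -> h (own a) <= mass k h.
Proof.
  intros h_nonneg a_lt.
  assert (post_nonneg : forall b, (b < V)%nat -> 0 <= rsum k (fun t => h (post t b))).
  { intros b b_lt. apply rsum_nonneg. intros t t_lt. apply h_nonneg; split; assumption. }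
  apply Rle_trans with (holding k h a).
  - unfold holding. specialize (post_nonneg a a_lt). lra.
  - apply rsum_term_le; [|exact a_lt]. intros b b_lt. unfold holding.
    specialize (post_nonneg b b_lt). pose proof (h_nonneg (own b) b_lt). lra.
Qed.

Lemma cabs_nonneg k h : mass_nonneg k (cabs h).
Proof. intros c _. apply Rabs_pos. Qed.

Lemma mass_cabs_of_nonneg k h : mass_nonneg k h -> mass k (cabs h) = mass k h.
Proof.
  intros h_nonneg. apply Rle_antisym; apply mass_mono; intros c c_live; unfold cabs.
  - rewrite Rabs_pos_eq by (apply h_nonneg, c_live). lra.
  - apply Rle_abs.
Qed.

Lemma mass_cabs_add k h h' : mass k (cabs (cadd h h')) <= mass k (cabs h) + mass k (cabs h').
Proof. rewrite <- mass_add. apply mass_mono. intros; apply Rabs_triang. Qed.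

Lemma mass_cabs_scale k x h : mass k (cabs (cscale x h)) = Rabs x * mass k (cabs h).
Proof.
  rewrite <- mass_scale. f_equal.
  apply functional_extensionality; intros c. apply Rabs_mult.
Qed.

(* Since [A i j] vanishes off the edges, what is sent along edges and what is kept amount
   to the whole column. *)
Lemma holding_split_step k h a : (a < V)%nat ->
  holding (S k) (split_step k h) a
  = holding k h a + A a (agent k) * gathered k h
    - (if Nat.eqb a (agent k) then gathered k h else 0).
Proof.
  intros a_lt. unfold holding; simpl. rewrite Nat.eqb_refl.
  rewrite (rsum_ext k _ (fun t => h (post t a)
     - (if Nat.eqb a (agent k) then (if rcv k t then h (post t (agent k)) else 0) else 0))).
  2:{ intros t t_lt. destruct (Nat.eqb_spec t k); [lia|].
      destruct (Nat.eqb_spec a (agent k)) as [->|]; simpl; [destruct (rcv k t)|]; ring. }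
  rewrite rsum_minus. destruct (Nat.eqb_spec a (agent k)) as [->|inactive].
  - rewrite no_self_loop. unfold gathered. ring.
  - rewrite (rsum_eq_0 k (fun _ => 0)) by auto.
    destruct (E (agent k) a) eqn:edge; [ring|].
    rewrite (off_edge_weight _ _ _ _ A_weights) by auto. ring.
Qed.

Lemma mass_split_step k h : mass (S k) (split_step k h) = mass k h.
Proof.
  unfold mass. rewrite (rsum_ext V _ _ (holding_split_step k h)).
  rewrite rsum_minus, rsum_plus, rsum_indicator by apply agent_lt.
  rewrite (rsum_ext V (fun a => A a (agent k) * gathered k h)
             (fun a => gathered k h * A a (agent k))) by (intros; ring).
  rewrite rsum_scal, A_column_sum by apply agent_lt.
  change (rsum V (fun a => holding k h a)) with (rsum V (holding k h)). ring.
Qed.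

Lemma mass_split_evolve k s h : mass (k + s) (evolve split_step k s h) = mass k h.
Proof.
  apply (evolve_invariant split_step (fun k' h' => mass k' h' = mass k h)); [|reflexivity].
  intros k' h' <-. apply mass_split_step.
Qed.

Lemma mass_split_unit k : mass (S k) (split_unit k) = 1.
Proof.
  rewrite <- (A_column_sum _ (agent_lt k)). apply rsum_ext. intros a a_lt.
  unfold holding; simpl. rewrite Nat.eqb_refl, rsum_eq_0.
  - destruct (Nat.eqb_spec a (agent k)) as [->|inactive].
    + rewrite no_self_loop; simpl; ring.
    + destruct (E (agent k) a) eqn:edge; simpl; [ring|].
      rewrite (off_edge_weight _ _ _ _ A_weights) by auto. ring.
  - intros t t_lt. destruct (Nat.eqb_spec t k); [lia|reflexivity].
Qed.

Lemma split_unit_nonneg k : mass_nonneg (S k) (split_unit k).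
Proof.
  intros [a|t a] c_live; simpl.
  - destruct (Nat.eqb a (agent k)); [apply A_nonneg; exact c_live | lra].
  - destruct (_ && _); [apply A_nonneg; [apply c_live | apply agent_lt] | lra].
Qed.

Lemma own_le_gathered k h : mass_nonneg k h -> h (own (agent k)) <= gathered k h.
Proof.
  intros h_nonneg. unfold gathered.
  assert (0 <= rsum k (fun t => if rcv k t then h (post t (agent k)) else 0)); [|lra].
  apply rsum_nonneg. intros t t_lt.
  destruct (rcv k t); [apply h_nonneg; split; auto | lra].
Qed.

Lemma split_step_nonneg k h : mass_nonneg k h -> mass_nonneg (S k) (split_step k h).
Proof.
  intros h_nonneg.
  assert (0 <= gathered k h).
  { eapply Rle_trans; [|apply own_le_gathered, h_nonneg]. apply h_nonneg, agent_lt. }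
  assert (share_nonneg : forall a, (a < V)%nat -> 0 <= A a (agent k) * gathered k h)
    by (intros; apply Rmult_le_pos; [apply A_nonneg; auto | assumption]).
  intros [a|t a] c_live; cbn [split_step].
  - destruct (Nat.eqb_spec a (agent k)) as [->|]; [auto | apply h_nonneg, c_live].
  - destruct c_live as [a_lt t_lt]. destruct (Nat.eqb_spec t k).
    + destruct (E (agent k) a); [auto | lra].
    + destruct (Nat.eqb a (agent k) && rcv k t); [lra | apply h_nonneg; split; [|lia]; auto].
Qed.

Lemma split_evolve_nonneg k s h :
  mass_nonneg k h -> mass_nonneg (k + s) (evolve split_step k s h).
Proof. apply evolve_invariant, split_step_nonneg. Qed.

Lemma gathered_cabs k h : Rabs (gathered k h) <= gathered k (cabs h).
Proof.
  unfold gathered. eapply Rle_trans; [apply Rabs_triang|].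
  apply Rplus_le_compat_l. eapply Rle_trans; [apply rsum_Rabs|]. apply rsum_le.
  intros t _. destruct (rcv k t); [apply Rle_refl|]. rewrite Rabs_R0; apply Rle_refl.
Qed.

Lemma mass_cabs_split_step k h : mass (S k) (cabs (split_step k h)) <= mass k (cabs h).
Proof.
  rewrite <- (mass_split_step k (cabs h)). apply mass_mono.
  assert (share_le : forall a, (a < V)%nat ->
    Rabs (A a (agent k) * gathered k h) <= A a (agent k) * gathered k (cabs h)).
  { intros a a_lt. pose proof (A_nonneg a (agent k) a_lt (agent_lt k)).
    rewrite Rabs_mult, (Rabs_pos_eq (A _ _)) by assumption.
    apply Rmult_le_compat_l; [assumption | apply gathered_cabs]. }
  intros [a|t a] c_live; unfold cabs at 1; cbn [split_step].
  - destruct (Nat.eqb_spec a (agent k)) as [->|]; [auto | apply Rle_refl].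
  - destruct c_live as [a_lt _]. destruct (Nat.eqb t k).
    + destruct (E (agent k) a); [auto|]. rewrite Rabs_R0; lra.
    + destruct (Nat.eqb a (agent k) && rcv k t); [rewrite Rabs_R0|]; apply Rle_refl.
Qed.

(* With [k0] fixed, [holding k0] counts the mass already addressed to [a] at time [k0]. *)
Lemma split_step_keeps_old k0 k h a : (k0 <= k)%nat -> mass_nonneg k h -> (a < V)%nat ->
  mbar * holding k0 h a <= holding k0 (split_step k h) a.
Proof.
  intros k0_le h_nonneg a_lt.
  assert (own_nonneg : 0 <= h (own a)) by (apply h_nonneg, a_lt).
  assert (post_nonneg : forall t, (t < k)%nat -> 0 <= h (post t a))
    by (intros; apply h_nonneg; split; assumption).
  assert (holding_step : holding k0 (split_step k h) a
    = split_step k h (own a)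
      + rsum k0 (fun t => if Nat.eqb a (agent k) && rcv k t then 0 else h (post t a))).
  { unfold holding. f_equal. apply rsum_ext. intros t t_lt.
    simpl. destruct (Nat.eqb_spec t k); [lia | reflexivity]. }
  rewrite holding_step. unfold holding. simpl.
  destruct (Nat.eqb_spec a (agent k)) as [->|inactive]; simpl.
  - set (received := fun t => if rcv k t then h (post t (agent k)) else 0).
    rewrite (rsum_if k0 (rcv k)). fold received.
    assert (received_nonneg : forall t, (t < k)%nat -> 0 <= received t)
      by (intros t t_lt; unfold received; destruct (rcv k t); [auto | lra]).
    assert (gathered_ge : h (own (agent k)) + rsum k0 received <= gathered k h).
    { unfold gathered. fold received. replace k with (k0 + (k - k0))%nat at 3 by lia.
      rewrite rsum_add.
      assert (0 <= rsum (k - k0) (fun t => received (k0 + t)%nat))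
        by (apply rsum_nonneg; intros; apply received_nonneg; lia).
      lra. }
    assert (0 <= rsum k0 received)
      by (apply rsum_nonneg; intros; apply received_nonneg; lia).
    assert (0 <= rsum k0 (fun t => if rcv k t then 0 else h (post t (agent k)))).
    { apply rsum_nonneg. intros t t_lt. destruct (rcv k t); [lra | apply post_nonneg; lia]. }
    pose proof (diagonal_weight _ _ _ _ A_weights (agent k) a_lt). nra.
  - assert (0 <= rsum k0 (fun t => h (post t a)))
      by (apply rsum_nonneg; intros; apply post_nonneg; lia).
    nra.
Qed.

Lemma split_step_keeps k h a : mass_nonneg k h -> (a < V)%nat ->
  mbar * h (own a) <= split_step k h (own a).
Proof.
  intros h_nonneg a_lt.
  pose proof (split_step_keeps_old O k h a ltac:(lia) h_nonneg a_lt) as keeps.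
  unfold holding in keeps; cbn [rsum] in keeps. rewrite !Rplus_0_r in keeps. exact keeps.
Qed.

Lemma split_keeps k s h a : mass_nonneg k h -> (a < V)%nat ->
  mbar ^ s * h (own a) <= evolve split_step k s h (own a).
Proof.
  intros h_nonneg a_lt.
  apply (reaches_self _ split_step (fun h a => h (own a)) mass_nonneg V mbar);
    auto using split_step_nonneg, split_step_keeps.
Qed.

Lemma split_keeps_old k s h a : mass_nonneg k h -> (a < V)%nat ->
  mbar ^ s * holding k h a <= holding k (evolve split_step k s h) a.
Proof.
  intros h_nonneg a_lt. induction s as [|s IH]; [simpl; lra|]. simpl.
  apply Rle_trans with (mbar * holding k (evolve split_step k s h) a).
  - rewrite Rmult_assoc. apply Rmult_le_compat_l; lra.
  - apply split_step_keeps_old; [lia | apply split_evolve_nonneg, h_nonneg | exact a_lt].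
Qed.

Lemma old_post_received k u s h t : (k + D <= u < k + s)%nat -> (t < k)%nat ->
  evolve split_step k s h (post t (agent u)) = 0.
Proof.
  intros u_range t_lt. induction s as [|s IH]; [lia|]. simpl.
  destruct (Nat.eqb_spec t (k + s)); [lia|].
  destruct (Nat.eq_dec u (k + s)) as [->|].
  - rewrite Nat.eqb_refl, rcv_old by lia. reflexivity.
  - rewrite IH by lia. destruct (_ && _); reflexivity.
Qed.

Lemma split_collects k h a : mass_nonneg k h -> (a < V)%nat ->
  mbar ^ (D + T) * holding k h a <= evolve split_step k (D + T) h (own a).
Proof.
  intros h_nonneg a_lt. eapply Rle_trans; [apply split_keeps_old; assumption|].
  destruct (agent_recurrent (k + D)%nat a a_lt) as (u & u_range & <-).
  unfold holding. rewrite rsum_eq_0; [lra|].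
  intros t t_lt. apply old_post_received; lia.
Qed.

Lemma split_edge_passes j i : E j i = true -> forall k h, mass_nonneg k h ->
  exists s, (s <= T + (D + T))%nat /\
    mbar ^ s * h (own j) <= evolve split_step k s h (own i).
Proof.
  intros edge k h h_nonneg. destruct (edge_range _ _ graph _ _ edge) as [j_lt i_lt].
  destruct (agent_recurrent k j j_lt) as (u & u_range & u_active). subst j.
  set (s := (u - k)%nat). replace u with (k + s)%nat in * by lia.
  set (h' := evolve split_step k (S s) h).
  assert (h'_nonneg : mass_nonneg (k + S s) h') by (apply split_evolve_nonneg, h_nonneg).
  assert (sent : mbar ^ S s * h (own (agent (k + s))) <= h' (post (k + s) i)).
  { unfold h'; simpl. rewrite Nat.eqb_refl, edge, Rmult_assoc.
    pose proof (edge_weight _ _ _ _ A_weights i (agent (k + s)) i_lt j_lt edge).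
    pose proof (split_keeps k s h _ h_nonneg j_lt).
    pose proof (own_le_gathered _ _ (split_evolve_nonneg k s h h_nonneg)).
    apply Rmult_le_compat; try lra.
    apply Rmult_le_pos; [apply pow_le; lra | apply h_nonneg, j_lt]. }
  assert (addressed : h' (post (k + s) i) <= holding (k + S s) h' i).
  { unfold holding. pose proof (h'_nonneg (own i) i_lt).
    pose proof (rsum_term_le (k + S s) (fun t => h' (post t i)) (k + s)
      ltac:(intros; apply h'_nonneg; split; auto) ltac:(lia)) as term_le.
    simpl in term_le. lra. }
  exists (S s + (D + T))%nat. split; [lia|]. rewrite evolve_add. fold h'.
  apply pow_mult_le_trans with (holding (k + S s) h' i); [lra | lra |].
  apply split_collects; assumption.
Qed.

Lemma split_positivity : exists N eta, (0 < N)%nat /\ 0 < eta < 1 /\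
  forall k h i, (i < V)%nat -> mass_nonneg k h ->
    eta * mass k h <= evolve split_step k N h (own i).
Proof.
  destruct (uniformly_reaches _ split_step (fun h a => h (own a)) mass_nonneg V
              (T + (D + T)) E mbar) as [N all_reach];
    auto using split_step_nonneg, split_step_keeps, split_edge_passes.
  destruct (agent_recurrent O O V_pos) as (t & t_range & _).
  set (N' := (D + T + N)%nat).
  assert (V_ge_1 : 1 <= INR V) by (change 1 with (INR 1); apply le_INR; lia).
  assert (0 < mbar ^ N') by (apply pow_lt; lra).
  assert (mbar ^ N' < 1) by (apply pow_lt_1_compat; [lra | unfold N'; lia]).
  exists N', (mbar ^ N' / INR V). split; [unfold N'; lia|].
  assert (per_agent : INR V * (mbar ^ N' / INR V) = mbar ^ N') by (field; lra).
  split; [split; [apply Rdiv_lt_0_compat; lra | nra]|].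
  intros k h i i_lt h_nonneg. apply Rmult_le_reg_l with (INR V); [lra|].
  rewrite <- Rmult_assoc, per_agent, <- rsum_const. unfold mass. rewrite <- rsum_scal.
  apply rsum_le. intros a a_lt. unfold N'. rewrite evolve_add.
  apply pow_mult_le_trans with (evolve split_step k (D + T) h (own a)); [lra | |].
  - apply split_collects; assumption.
  - apply all_reach; [| |apply split_evolve_nonneg]; assumption.
Qed.

Lemma mass_overlap k p q i r : mass_nonneg k p -> mass_nonneg k q -> (i < V)%nat ->
  r <= p (own i) -> r <= q (own i) ->
  mass k (cabs (cadd p (cscale (-1) q))) <= mass k p + mass k q - 2 * r.
Proof.
  intros p_nonneg q_nonneg i_lt r_le_p r_le_q.
  set (overlap := fun c => match c with own a => if Nat.eqb a i then 1 else 0 | post _ _ => 0 end).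
  assert (overlap_mass : mass k overlap = 1).
  { unfold mass. rewrite <- (rsum_indicator V i 1 i_lt). apply rsum_ext. intros a _.
    unfold holding, overlap. rewrite rsum_eq_0 by auto. ring. }
  apply Rle_trans with (mass k (cadd (cadd p q) (cscale (- (2 * r)) overlap))).
  - apply mass_mono. intros c c_live.
    pose proof (p_nonneg c c_live). pose proof (q_nonneg c c_live).
    unfold cabs, cadd, cscale, overlap. apply Rabs_le.
    destruct c as [a|t a]; [destruct (Nat.eqb_spec a i) as [->|]|]; lra.
  - rewrite !mass_add, mass_scale, overlap_mass. lra.
Qed.

(* The positive and negative parts of a configuration of total mass zero have equal mass,
   and part of both ends up at agent [i], where it cancels. *)
Lemma split_contraction N eta i : (i < V)%nat ->
  (forall k h, mass_nonneg k h ->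
    eta * mass k h <= evolve split_step k N h (own i)) ->
  forall k h, mass k h = 0 ->
    mass (k + N) (cabs (evolve split_step k N h)) <= (1 - eta) * mass k (cabs h).
Proof.
  intros i_lt positivity k h mass_0.
  set (p := cscale (/2) (cadd (cabs h) h)).
  set (q := cscale (/2) (cadd (cabs h) (cscale (-1) h))).
  assert (p_nonneg : mass_nonneg k p).
  { intros c _. unfold p, cscale, cadd, cabs.
    pose proof (Rle_abs (- h c)) as abs_ge. rewrite Rabs_Ropp in abs_ge. lra. }
  assert (q_nonneg : mass_nonneg k q).
  { intros c _. unfold q, cscale, cadd, cabs. pose proof (Rle_abs (h c)). lra. }
  assert (p_mass : mass k p = mass k (cabs h) / 2)
    by (unfold p; rewrite mass_scale, mass_add, mass_0; field).
  assert (q_mass : mass k q = mass k (cabs h) / 2)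
    by (unfold q; rewrite mass_scale, mass_add, mass_scale, mass_0; field).
  assert (h_parts : h = cadd p (cscale (-1) q)).
  { apply functional_extensionality; intros c. unfold p, q, cscale, cadd; field. }
  pose proof (evolve_linear split_step split_step_linear k N) as evolve_lin.
  rewrite h_parts at 1. rewrite (linear_add _ evolve_lin), (linear_scale _ evolve_lin).
  eapply Rle_trans; [apply mass_overlap with (i := i) (r := eta * (mass k (cabs h) / 2))|].
  1, 2: apply split_evolve_nonneg; assumption.
  - exact i_lt.
  - rewrite <- p_mass. apply positivity; assumption.
  - rewrite <- q_mass. apply positivity; assumption.
  - rewrite !mass_split_evolve, p_mass, q_mass. lra.
Qed.

Lemma split_stable : input_to_state_stable cadd split_step balanced.
Proof.
  destruct split_positivity as (N & eta & N_pos & eta_range & positivity).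
  apply (contraction_stable config cadd split_step balanced eta N); auto.
  - intros k. apply linear_add, split_step_linear.
  - intros k h r r' r_le [mass_0 mass_le]. split; [exact mass_0 | lra].
  - intros k h h' r r' [mass_0 mass_le] [mass_0' mass_le']. split.
    + rewrite mass_add, mass_0, mass_0'; ring.
    + eapply Rle_trans; [apply mass_cabs_add | lra].
  - intros k h r [mass_0 mass_le]. split; [rewrite mass_split_step; exact mass_0|].
    eapply Rle_trans; [apply mass_cabs_split_step | exact mass_le].
  - intros k h r _ [mass_0 mass_le]. split; [rewrite mass_split_evolve; exact mass_0|].
    eapply Rle_trans; [apply (split_contraction N eta O); auto|].
    apply Rmult_le_compat_l; lra.
Qed.

Lemma balanced_scale k x h r : balanced k h r -> balanced k (cscale x h) (Rabs x * r).
Proof.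
  intros [mass_0 mass_le]. split; [rewrite mass_scale, mass_0; ring|].
  rewrite mass_cabs_scale. apply Rmult_le_compat_l; [apply Rabs_pos | exact mass_le].
Qed.

Lemma balanced_sub k h h' x : mass_nonneg k h -> mass_nonneg k h' ->
  mass k h = x -> mass k h' = x -> balanced k (cadd h (cscale (-1) h')) (2 * x).
Proof.
  intros h_nonneg h'_nonneg h_mass h'_mass. split.
  - rewrite mass_add, mass_scale, h_mass, h'_mass; ring.
  - eapply Rle_trans; [apply mass_cabs_add|].
    rewrite mass_cabs_scale, !mass_cabs_of_nonneg, h_mass, h'_mass by assumption.
    rewrite Rabs_left by lra. lra.
Qed.

Lemma balanced_own_le k h r a : balanced k h r -> (a < V)%nat -> Rabs (h (own a)) <= r.
Proof.
  intros [_ mass_le] a_lt. eapply Rle_trans; [|exact mass_le].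
  apply (own_le_mass k (cabs h)); [apply cabs_nonneg | exact a_lt].
Qed.

End MassSplitting.

(** * Euclidean norm and gradients *)

Local Ltac vec_ring :=
  apply functional_extensionality; intros ?; unfold vadd, vsub, vscale; ring.

Lemma inner_comm n u v : inner n u v = inner n v u.
Proof. apply rsum_ext. intros; apply Rmult_comm. Qed.

Lemma inner_vadd_r n u v w : inner n u (vadd v w) = inner n u v + inner n u w.
Proof.
  unfold inner. rewrite <- rsum_plus. apply rsum_ext. intros l _. unfold vadd; ring.
Qed.

Lemma inner_vscale_r n u x v : inner n u (vscale x v) = x * inner n u v.
Proof.
  unfold inner. rewrite <- rsum_scal. apply rsum_ext. intros l _. unfold vscale; ring.
Qed.

Lemma inner_vscale_l n x u v : inner n (vscale x u) v = x * inner n u v.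
Proof. rewrite inner_comm, inner_vscale_r, inner_comm. reflexivity. Qed.

Lemma inner_vsum_l n m F v : inner n (vsum m F) v = rsum m (fun j => inner n (F j) v).
Proof.
  unfold inner, vsum. rewrite rsum_exchange. apply rsum_ext. intros l _.
  rewrite Rmult_comm, <- rsum_scal. apply rsum_ext. intros; ring.
Qed.

Lemma sqnorm_nonneg n v : 0 <= sqnorm n v.
Proof. apply rsum_nonneg. intros; apply Rle_0_sqr. Qed.

Lemma norm_nonneg n v : 0 <= norm n v.
Proof. apply sqrt_pos. Qed.

Lemma norm_sqr n v : (norm n v)² = sqnorm n v.
Proof. apply Rsqr_sqrt, sqnorm_nonneg. Qed.

Lemma sqnorm_vadd n u v :
  sqnorm n (vadd u v) = sqnorm n u + 2 * inner n u v + sqnorm n v.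
Proof.
  unfold sqnorm. rewrite inner_vadd_r, !(inner_comm n (vadd u v)), !inner_vadd_r.
  rewrite (inner_comm n v u). ring.
Qed.

Lemma norm_vscale n x v : norm n (vscale x v) = Rabs x * norm n v.
Proof.
  unfold norm, sqnorm. rewrite inner_vscale_r, inner_vscale_l, <- Rmult_assoc.
  change (x * x) with x².
  rewrite sqrt_mult, sqrt_Rsqr_abs by (apply Rle_0_sqr || apply sqnorm_nonneg). reflexivity.
Qed.

Lemma coord_le_norm n v l : (l < n)%nat -> Rabs (v l) <= norm n v.
Proof.
  intros l_lt. apply Rsqr_incr_0_var; [|apply norm_nonneg].
  rewrite norm_sqr, <- Rsqr_abs.
  apply (rsum_term_le n (fun l => v l * v l)); [intros; apply Rle_0_sqr | exact l_lt].
Qed.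

Lemma inner_eq_0_of_norm n u v : norm n u = 0 -> inner n u v = 0.
Proof.
  intros u_0. apply rsum_eq_0. intros l l_lt.
  pose proof (coord_le_norm n u l l_lt) as u_l. rewrite u_0 in u_l.
  destruct (Req_dec (u l) 0) as [-> | ul_nonzero]; [ring|].
  pose proof (Rabs_pos_lt _ ul_nonzero). lra.
Qed.

Lemma cauchy_schwarz n u v : inner n u v <= norm n u * norm n v.
Proof.
  set (a := norm n u). set (b := norm n v).
  pose proof (norm_nonneg n u : 0 <= a) as a_nonneg.
  pose proof (norm_nonneg n v : 0 <= b) as b_nonneg.
  destruct (Req_dec a 0) as [a_0|a_nonzero].
  { rewrite (inner_eq_0_of_norm n u v a_0), a_0. lra. }
  destruct (Req_dec b 0) as [b_0|b_nonzero].
  { rewrite inner_comm, (inner_eq_0_of_norm n v u b_0), b_0. lra. }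
  assert (ab_pos : 0 < a * b) by (apply Rmult_lt_0_compat; lra).
  pose proof (sqnorm_nonneg n (vadd (vscale b u) (vscale (- a) v))) as square.
  rewrite sqnorm_vadd, <- !norm_sqr, !norm_vscale, Rabs_Ropp, !Rabs_pos_eq,
    inner_vscale_r, inner_vscale_l in square by assumption.
  fold a b in square. unfold Rsqr in square.
  apply Rmult_le_reg_l with (a * b); [exact ab_pos | lra].
Qed.

Lemma norm_vadd n u v : norm n (vadd u v) <= norm n u + norm n v.
Proof.
  pose proof (norm_nonneg n u). pose proof (norm_nonneg n v).
  apply Rsqr_incr_0_var; [|lra].
  rewrite Rsqr_plus, !norm_sqr, sqnorm_vadd. pose proof (cauchy_schwarz n u v). lra.
Qed.

Lemma norm_vsub_comm n u v : norm n (vsub u v) = norm n (vsub v u).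
Proof.
  replace (vsub u v) with (vscale (-1) (vsub v u)) by vec_ring.
  rewrite norm_vscale, Rabs_left by lra. ring.
Qed.

Lemma norm_le_via n u v : norm n u <= norm n v + norm n (vsub u v).
Proof. replace u with (vadd v (vsub u v)) at 1 by vec_ring. apply norm_vadd. Qed.

Lemma norm_vsum n m F : norm n (vsum m F) <= rsum m (fun j => norm n (F j)).
Proof.
  induction m as [|m IH].
  - replace (vsum 0 F) with (vscale 0 (vsum 0 F))
      by (apply functional_extensionality; intros l; apply Rmult_0_l).
    rewrite norm_vscale, Rabs_R0. simpl; lra.
  - change (vsum (S m) F) with (vadd (vsum m F) (F m)).
    eapply Rle_trans; [apply norm_vadd | simpl; lra].
Qed.

Lemma norm_le_coords n v r : 0 <= r -> (forall l, (l < n)%nat -> Rabs (v l) <= r) ->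
  norm n v <= sqrt (INR n) * r.
Proof.
  intros r_nonneg coords_le.
  rewrite <- (sqrt_Rsqr r), <- sqrt_mult by (assumption || apply pos_INR || apply Rle_0_sqr).
  apply sqrt_le_1_alt. rewrite <- rsum_const. apply rsum_le. intros l l_lt.
  apply (Rsqr_le_abs_1 (v l) r). rewrite (Rabs_pos_eq r) by assumption. auto.
Qed.

Lemma xbar_near n V x y r : (0 < V)%nat ->
  (forall i, (i < V)%nat -> norm n (vsub (x i) y) <= r) -> norm n (vsub (xbar V x) y) <= r.
Proof.
  intros V_pos x_near.
  assert (0 < INR V) by (apply lt_0_INR; exact V_pos).
  replace (vsub (xbar V x) y) with (vscale (/ INR V) (vsum V (fun i => vsub (x i) y))).
  - rewrite norm_vscale, Rabs_pos_eq by (apply Rlt_le, Rinv_0_lt_compat; assumption).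
    replace r with (/ INR V * (INR V * r)) by (field; lra).
    apply Rmult_le_compat_l; [apply Rlt_le, Rinv_0_lt_compat; assumption|].
    rewrite <- rsum_const. eapply Rle_trans; [apply norm_vsum | apply rsum_le; assumption].
  - apply functional_extensionality; intros l. unfold xbar, vscale, vsub, vsum.
    rewrite rsum_minus, rsum_const. field; lra.
Qed.

Definition lipschitz (n : nat) (L : R) (g : vec -> vec) : Prop :=
  forall x y, norm n (vsub (g x) (g y)) <= L * norm n (vsub x y).

Lemma gradient_along_line n f g y h t : is_gradient n f g ->
  derivable_pt_lim (fun s => f (vadd y (vscale s h))) t
                   (inner n (g (vadd y (vscale t h))) h).
Proof.
  intros grad eps eps_pos. set (x := vadd y (vscale t h)).
  set (N := norm n h). assert (N_nonneg : 0 <= N) by apply norm_nonneg.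
  assert (slope_pos : 0 < eps / (N + 1)) by (apply Rdiv_lt_0_compat; lra).
  assert (slope_eq : eps / (N + 1) * (N + 1) = eps) by (field; lra).
  destruct (grad x (eps / (N + 1)) slope_pos) as (delta & delta_pos & expansion).
  assert (radius_pos : 0 < delta / (N + 1)) by (apply Rdiv_lt_0_compat; lra).
  assert (radius_eq : delta / (N + 1) * (N + 1) = delta) by (field; lra).
  exists (mkposreal _ radius_pos). intros s s_nonzero s_small. simpl in s_small.
  assert (s_pos : 0 < Rabs s) by (apply Rabs_pos_lt; exact s_nonzero).
  specialize (expansion (vscale s h)).
  rewrite norm_vscale, inner_vscale_r in expansion. fold N in expansion.
  specialize (expansion ltac:(nra)).
  replace (vadd x (vscale s h)) with (vadd y (vscale (t + s) h)) in expansion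
    by (unfold x; vec_ring).
  replace ((f (vadd y (vscale (t + s) h)) - f x) / s - inner n (g x) h)
    with ((f (vadd y (vscale (t + s) h)) - f x - s * inner n (g x) h) / s)
    by (field; exact s_nonzero).
  unfold Rdiv. rewrite Rabs_mult, Rabs_inv.
  apply Rmult_lt_reg_r with (Rabs s); [exact s_pos|].
  rewrite Rmult_assoc, Rinv_l, Rmult_1_r by lra. nra.
Qed.

Lemma descent_inequality n f g L : is_gradient n f g -> lipschitz n L g ->
  forall y h, f (vadd y h) <= f y + inner n (g y) h + Rabs L * sqnorm n h.
Proof.
  intros grad lip y h.
  destruct (MVT_cor2 (fun s => f (vadd y (vscale s h)))
              (fun s => inner n (g (vadd y (vscale s h))) h) 0 1 Rlt_0_1)
    as (s & mean_value & s_range).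
  { intros s _. apply gradient_along_line, grad. }
  replace (vadd y (vscale 1 h)) with (vadd y h) in mean_value by vec_ring.
  replace (vadd y (vscale 0 h)) with y in mean_value by vec_ring.
  set (x := vadd y (vscale s h)) in *.
  assert (grad_split : inner n (g x) h = inner n (g y) h + inner n (vsub (g x) (g y)) h).
  { rewrite !(inner_comm n _ h), <- inner_vadd_r. f_equal. vec_ring. }
  assert (grad_close : norm n (vsub (g x) (g y)) <= Rabs L * norm n h).
  { eapply Rle_trans; [apply lip|].
    replace (vsub x y) with (vscale s h) by (unfold x; vec_ring).
    rewrite norm_vscale, (Rabs_pos_eq s) by lra.
    pose proof (norm_nonneg n h). pose proof (Rle_abs L). pose proof (Rabs_pos L).
    apply Rle_trans with (Rabs L * (s * norm n h)).
    - apply Rmult_le_compat_r; [apply Rmult_le_pos|]; lra.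
    - apply Rmult_le_compat_l; nra. }
  pose proof (cauchy_schwarz n (vsub (g x) (g y)) h).
  assert (norm n (vsub (g x) (g y)) * norm n h <= Rabs L * sqnorm n h).
  { rewrite <- norm_sqr. unfold Rsqr. rewrite <- Rmult_assoc.
    apply Rmult_le_compat_r; [apply norm_nonneg | exact grad_close]. }
  lra.
Qed.

(** * Lyapunov decrease *)

Lemma sqr_add_le x y : (x + y)² <= 2 * x² + 2 * y².
Proof. pose proof (Rle_0_sqr (x - y)). unfold Rsqr in *. lra. Qed.

Lemma sqr_contraction_le rho c r e : 0 < rho < 1 ->
  (rho * r + c * e)² <= rho * r² + c² / (1 - rho) * e².
Proof.
  intros rho_range. set (x := c * e / (1 - rho)).
  replace (c * e) with ((1 - rho) * x) by (unfold x; field; lra).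
  replace (c² / (1 - rho) * e²) with ((1 - rho) * x²) by (unfold x, Rsqr; field; lra).
  assert (0 <= rho * (1 - rho) * (r - x)²)
    by (apply Rmult_le_pos; [apply Rmult_le_pos; lra | apply Rle_0_sqr]).
  unfold Rsqr in *. lra.
Qed.

Lemma small_multiplier x y : 0 <= x -> 0 < y ->
  exists bound, 0 < bound /\ forall t, 0 <= t <= bound -> x * t <= y.
Proof.
  intros x_nonneg y_pos. exists (y / (x + 1)).
  assert (bound_eq : y / (x + 1) * (x + 1) = y) by (field; lra).
  split; [apply Rdiv_lt_0_compat; lra|]. intros t t_range. nra.
Qed.

Local Ltac nonneg_product := repeat (apply Rle_0_sqr || apply Rmult_le_pos); lra.

(* Young: [G s <= eta G^2 / 2 + s^2 / (2 eta)] *)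
Lemma descent_term_ge gam beta beta0 eta G s ip :
  0 <= gam -> 0 < beta0 <= beta -> beta <= 1 -> 0 < eta ->
  eta * G² - G * s <= ip ->
  beta0 * eta / 2 * (gam * G²) - / (2 * eta) * (gam * s²) <= gam * beta * ip.
Proof.
  intros gam_nonneg beta_ge beta_le eta_pos ip_ge.
  assert (inv_pos : 0 < / (2 * eta)) by (apply Rinv_0_lt_compat; lra).
  assert (young : eta / 2 * G² - / (2 * eta) * s² <= ip).
  { assert (0 <= / (2 * eta) * (eta * G - s)²)
      by (apply Rmult_le_pos; [lra | apply Rle_0_sqr]).
    replace (/ (2 * eta) * (eta * G - s)²)
      with (eta / 2 * G² - G * s + / (2 * eta) * s²) in * by (unfold Rsqr; field; lra).
    lra. }
  set (nu := / (2 * eta)) in *. clearbody nu.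
  assert (0 <= gam * beta) by (apply Rmult_le_pos; lra).
  assert (0 <= eta / 2 * (gam * G²) * (beta - beta0))
    by nonneg_product.
  assert (0 <= nu * (gam * s²) * (1 - beta))
    by nonneg_product.
  apply Rmult_le_compat_l with (r := gam * beta) in young; lra.
Qed.

Section LyapunovDecrease.

Variables (rho_x d_x rho_z d_z kappa nu L P : R).
Hypothesis rho_x_range : 0 < rho_x < 1.
Hypothesis rho_z_range : 0 < rho_z < 1.
Hypothesis d_x_nonneg : 0 <= d_x.
Hypothesis d_z_nonneg : 0 <= d_z.
Hypothesis kappa_pos : 0 < kappa.
Hypothesis nu_nonneg : 0 <= nu.
Hypothesis L_nonneg : 0 <= L.
Hypothesis P_nonneg : 0 <= P.

(* Chosen so that the contraction of the consensus error outweighs its contribution to the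
   tracking error. *)
Definition consensus_weight : R := (d_z + 2) / (1 - rho_x).

Definition move_cost : R := L + consensus_weight * d_x + d_z.

Lemma consensus_weight_nonneg : 0 <= consensus_weight.
Proof. apply Rlt_le, Rdiv_lt_0_compat; lra. Qed.

Lemma move_cost_nonneg : 0 <= move_cost.
Proof.
  pose proof (Rmult_le_pos _ _ consensus_weight_nonneg d_x_nonneg). unfold move_cost. lra.
Qed.

(* The suffix [2] marks squares: of the gradient norm, of the consensus and tracking errors,
   of the resulting error on the search direction, and of the step length. *)
Lemma lyapunov_step gam grad2 cons2 track2 dir2 move2 F F' cons2' track2' :
  0 <= gam -> 2 * move_cost * gam <= kappa / 2 -> (nu + kappa / 2) * P * gam <= 1 - rho_z ->
  0 <= grad2 -> 0 <= cons2 -> 0 <= track2 -> 0 <= dir2 ->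
  dir2 <= P * (cons2 + track2) ->
  move2 <= 2 * gam² * (grad2 + dir2) ->
  cons2' <= rho_x * cons2 + d_x * move2 ->
  track2' <= rho_z * track2 + d_z * (cons2 + move2) ->
  F' <= F - kappa * (gam * grad2) + nu * (gam * dir2) + L * move2 ->
  F' + consensus_weight * cons2' + track2'
  <= F + consensus_weight * cons2 + track2 - Rmin (kappa / 2) 1 * (gam * grad2 + cons2).
Proof.
  intros gam_nonneg move_small dir_small grad2_nonneg cons2_nonneg track2_nonneg dir2_nonneg
    dir2_le move2_le cons2'_le track2'_le F'_le.
  assert (move_term : move_cost * move2 <= kappa / 2 * (gam * (grad2 + dir2))).
  { apply Rle_trans with (2 * move_cost * gam * (gam * (grad2 + dir2))).
    - apply Rmult_le_compat_l with (r := move_cost) in move2_le; [|apply move_cost_nonneg].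
      unfold Rsqr in move2_le. lra.
    - apply Rmult_le_compat_r; [apply Rmult_le_pos; lra | exact move_small]. }
  assert (direction_term : (nu + kappa / 2) * (gam * dir2) <= (1 - rho_z) * (cons2 + track2)).
  { apply Rle_trans with ((nu + kappa / 2) * P * gam * (cons2 + track2)).
    - replace ((nu + kappa / 2) * P * gam * (cons2 + track2))
        with ((nu + kappa / 2) * (gam * (P * (cons2 + track2)))) by ring.
      apply Rmult_le_compat_l; [lra|]. apply Rmult_le_compat_l; assumption.
    - apply Rmult_le_compat_r; [lra | exact dir_small]. }
  assert (consensus_term : consensus_weight * cons2'
    <= consensus_weight * cons2 - (d_z + 2) * cons2 + consensus_weight * d_x * move2).
  { apply Rmult_le_compat_l with (r := consensus_weight) in cons2'_le;
      [|apply consensus_weight_nonneg].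
    replace (d_z + 2) with (consensus_weight * (1 - rho_x))
      by (unfold consensus_weight; field; lra).
    lra. }
  assert (rate_term : Rmin (kappa / 2) 1 * (gam * grad2 + cons2)
                      <= kappa / 2 * (gam * grad2) + cons2).
  { pose proof (Rmin_l (kappa / 2) 1). pose proof (Rmin_r (kappa / 2) 1).
    pose proof (Rmult_le_pos _ _ gam_nonneg grad2_nonneg). nra. }
  pose proof (Rmult_le_pos rho_z cons2 ltac:(lra) cons2_nonneg).
  unfold move_cost in move_term. lra.
Qed.

Lemma lyapunov_threshold : exists gam_max, 0 < gam_max <= 1 /\
  forall gam, 0 <= gam <= gam_max ->
    2 * move_cost * gam <= kappa / 2 /\ (nu + kappa / 2) * P * gam <= 1 - rho_z.
Proof.
  pose proof move_cost_nonneg.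
  destruct (small_multiplier (2 * move_cost) (kappa / 2))
    as (gam_move & gam_move_pos & move_small); [lra | lra |].
  destruct (small_multiplier ((nu + kappa / 2) * P) (1 - rho_z))
    as (gam_dir & gam_dir_pos & dir_small); [apply Rmult_le_pos; lra | lra |].
  exists (Rmin 1 (Rmin gam_move gam_dir)).
  split; [split; [repeat apply Rmin_pos; lra | apply Rmin_l]|]. intros gam gam_range.
  pose proof (Rmin_r 1 (Rmin gam_move gam_dir)).
  pose proof (Rmin_l gam_move gam_dir). pose proof (Rmin_r gam_move gam_dir).
  split; [apply move_small | apply dir_small]; lra.
Qed.

End LyapunovDecrease.

(* The potentials depend on a horizon [K], and the sum stops [N] steps before it; letting
   the horizon grow costs nothing since the bounds on the potentials do not depend on it. *)
Lemma rsum_bounded_by_potentials (term : nat -> R) (Phi : nat -> nat -> R) (k0 N : nat)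
    (c lower upper : R) :
  0 <= c -> (forall k, 0 <= term k) ->
  (forall K k, (k0 <= k)%nat -> (k + N < K)%nat -> term k <= c * (Phi K k - Phi K (S k))) ->
  (forall K, Phi K k0 <= upper) -> (forall K k, lower <= Phi K k) ->
  forall m, rsum m term <= rsum k0 term + c * (upper - lower).
Proof.
  intros c_nonneg term_nonneg decrease Phi_upper Phi_lower m.
  set (K := (k0 + m + N + 1)%nat).
  assert (telescope : forall p, (p <= m)%nat ->
    rsum p (fun t => term (k0 + t)%nat) <= c * (Phi K k0 - Phi K (k0 + p)%nat)).
  { induction p as [|p IH]; intros p_le; simpl; [rewrite Nat.add_0_r; lra|].
    rewrite Nat.add_succ_r. specialize (IH ltac:(lia)).
    pose proof (decrease K (k0 + p)%nat ltac:(lia) ltac:(unfold K; lia)). lra. }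
  apply Rle_trans with (rsum (k0 + m) term).
  - rewrite Nat.add_comm, rsum_add.
    pose proof (rsum_nonneg k0 (fun t => term (m + t)%nat) (fun _ _ => term_nonneg _)). lra.
  - rewrite rsum_add. apply Rplus_le_compat_l.
    eapply Rle_trans; [apply telescope; lia|]. apply Rmult_le_compat_l; [exact c_nonneg|].
    pose proof (Phi_upper K). pose proof (Phi_lower K (k0 + m)%nat). lra.
Qed.

(** * ASY-SONATA as two perturbed linear systems *)

Section AsySonata.

Variables (n V T D : nat) (E : nat -> nat -> bool) (W A : nat -> nat -> R) (mbar : R).
Variables (f : nat -> vec -> R) (g : nat -> vec -> vec) (L : nat -> R).
Variables (agent : nat -> nat) (d : nat -> nat -> nat) (gamma : nat -> R) (x0 : nat -> vec).
Hypothesis V_pos : (0 < V)%nat.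
Hypothesis f_gradient : forall i, (i < V)%nat -> is_gradient n (f i) (g i).
Hypothesis g_lipschitz : forall i, (i < V)%nat -> lipschitz n (L i) (g i).
Hypothesis objective_bounded_below : exists lb, forall x, lb <= rsum V (fun i => f i x).
Hypothesis graph : strongly_connected V E.
Hypothesis no_self_loop : forall i, E i i = false.
Hypothesis mbar_range : 0 < mbar < 1.
Hypothesis W_weights : weights V E mbar W.
Hypothesis W_row_sum : forall i, (i < V)%nat -> rsum V (fun j => W i j) = 1.
Hypothesis A_weights : weights V E mbar A.
Hypothesis A_column_sum : forall j, (j < V)%nat -> rsum V (fun i => A i j) = 1.
Hypothesis agent_lt : forall k, (agent k < V)%nat.
Hypothesis agent_recurrent : recurrent V T agent.
Hypothesis delay_le : forall k j, E j (agent k) = true -> (d k j <= D)%nat.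
Hypothesis gamma_nonneg : forall k, 0 <= gamma k.
Hypothesis gamma_cv_0 : Un_cv gamma 0.

Definition run (k : nat) : state := asy_run V E W A g agent d gamma D x0 k.

Definition direction (k : nat) : vec := sz (run k) (agent k).

Definition xnew (k : nat) : vec := sx (run (S k)) (agent k).

Definition grad_change (k : nat) : vec :=
  vsub (g (agent k) (xnew k)) (g (agent k) (sx (run k) (agent k))).

Definition zhalf (k : nat) : vec :=
  let i := agent k in
  vadd (vadd (sz (run k) i)
             (vsum V (fun j => if E j i
                then vsub (srho (run k) (stau (run (S k)) i j) i j) (srt (run k) i j)
                else vzero)))
       (grad_change k).

(* [tau_(aj)^(k-1)], truncated at [0]: no message carries an earlier date. *)
Definition read_time (k a j : nat) : nat := Z.to_nat (stau (run k) a j).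

Lemma xnew_eq k : xnew k =
  vadd (vscale (W (agent k) (agent k))
               (vsub (sx (run k) (agent k)) (vscale (gamma k) (direction k))))
       (vsum V (fun j => if E j (agent k)
          then vscale (W (agent k) j) (sv (run k) (stau (run (S k)) (agent k) j) j)
          else vzero)).
Proof. unfold xnew, direction, run; simpl. rewrite Nat.eqb_refl. reflexivity. Qed.

Lemma sx_S k a : sx (run (S k)) a = if Nat.eqb a (agent k) then xnew k else sx (run k) a.
Proof. rewrite xnew_eq. reflexivity. Qed.

Lemma sz_S k a : sz (run (S k)) a =
  if Nat.eqb a (agent k) then vscale (A (agent k) (agent k)) (zhalf k) else sz (run k) a.
Proof. unfold zhalf, grad_change. rewrite xnew_eq. reflexivity. Qed.

Lemma stau_S k a j : stau (run (S k)) a j =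
  if Nat.eqb a (agent k) && E j (agent k)
  then Z.max (stau (run k) a j) (Z.of_nat k - Z.of_nat (d k j))%Z
  else stau (run k) a j.
Proof. reflexivity. Qed.

Lemma srt_S k a j : srt (run (S k)) a j =
  if Nat.eqb a (agent k) && E j (agent k)
  then srho (run k) (stau (run (S k)) (agent k) j) (agent k) j else srt (run k) a j.
Proof. reflexivity. Qed.

Lemma sv_S k t a : sv (run (S k)) t a =
  if Z.eqb t (Z.of_nat k + 1)
  then (if Nat.eqb a (agent k)
        then vsub (sx (run k) (agent k)) (vscale (gamma k) (direction k))
        else sv (run k) (Z.of_nat k) a)
  else sv (run k) t a.
Proof. reflexivity. Qed.

Lemma srho_S k t a b : srho (run (S k)) t a b =
  if Z.eqb t (Z.of_nat k + 1)
  then (if Nat.eqb b (agent k) && E (agent k) a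
        then vadd (srho (run k) (Z.of_nat k) a (agent k)) (vscale (A a (agent k)) (zhalf k))
        else srho (run k) (Z.of_nat k) a b)
  else srho (run k) t a b.
Proof. unfold zhalf, grad_change. rewrite xnew_eq. reflexivity. Qed.

Lemma run_0 : run 0 = asy_init D g x0.
Proof. reflexivity. Qed.

Local Opaque run.

Lemma sv_nonpos k t a : (t <= 0)%Z -> sv (run k) t a = vzero.
Proof.
  intros t_nonpos. induction k as [|k IH]; [rewrite run_0; reflexivity|].
  rewrite sv_S. destruct (Z.eqb_spec t (Z.of_nat k + 1)); [lia | exact IH].
Qed.

Lemma srho_nonpos k t a b : (t <= 0)%Z -> srho (run k) t a b = vzero.
Proof.
  intros t_nonpos. induction k as [|k IH]; [rewrite run_0; reflexivity|].
  rewrite srho_S. destruct (Z.eqb_spec t (Z.of_nat k + 1)); [lia | exact IH].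
Qed.

Lemma sv_truncate k t a : sv (run k) t a = sv (run k) (Z.of_nat (Z.to_nat t)) a.
Proof.
  destruct (Z_le_gt_dec t 0).
  - rewrite !sv_nonpos by lia. reflexivity.
  - rewrite Z2Nat.id by lia. reflexivity.
Qed.

Lemma srho_truncate k t a b : srho (run k) t a b = srho (run k) (Z.of_nat (Z.to_nat t)) a b.
Proof.
  destruct (Z_le_gt_dec t 0).
  - rewrite !srho_nonpos by lia. reflexivity.
  - rewrite Z2Nat.id by lia. reflexivity.
Qed.

Lemma stau_le k a j : (stau (run k) a j <= Z.of_nat k)%Z.
Proof.
  induction k as [|k IH]; [rewrite run_0; simpl; lia|].
  rewrite stau_S. destruct (_ && _); lia.
Qed.

Lemma read_time_0 a j : read_time 0 a j = O.
Proof. unfold read_time. rewrite run_0; simpl. lia. Qed.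

Lemma read_time_S_le k a j : (read_time (S k) a j <= k)%nat.
Proof.
  unfold read_time. rewrite stau_S. pose proof (stau_le k a j). destruct (_ && _); lia.
Qed.

Lemma read_time_mono k a j : (read_time k a j <= read_time (S k) a j)%nat.
Proof. unfold read_time. rewrite stau_S. destruct (_ && _); lia. Qed.

Lemma read_time_inactive k a j : a <> agent k -> read_time (S k) a j = read_time k a j.
Proof.
  intros inactive. unfold read_time. rewrite stau_S.
  destruct (Nat.eqb_spec a (agent k)); [contradiction | reflexivity].
Qed.

Definition src (k j : nat) : nat := read_time (S k) (agent k) j.

Definition rcv (k t : nat) : bool :=
  negb (E (agent t) (agent k)) || Nat.ltb t (src k (agent t)).

Lemma src_window k j : E j (agent k) = true -> (k - D <= src k j <= k)%nat.
Proof.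
  intros edge. split; [|apply read_time_S_le].
  unfold src, read_time. rewrite stau_S, Nat.eqb_refl, edge.
  pose proof (delay_le k j edge). simpl; lia.
Qed.

Lemma rcv_old k t : (t + D < k)%nat -> rcv k t = true.
Proof.
  intros t_old. unfold rcv. destruct (E (agent t) (agent k)) eqn:edge; [|reflexivity].
  apply Nat.ltb_lt. pose proof (src_window k _ edge). lia.
Qed.

Notation xstep := (avg_step V E W agent src).
Notation zstep := (split_step E A agent rcv).

(** ** The averaging system *)

Definition x_state (k l : nat) : config := fun c =>
  match c with own a => sx (run k) a l | post t a => sv (run k) (Z.of_nat t) a l end.

Definition x_unit (k : nat) : config := fun c =>
  match c with
  | own a => if Nat.eqb a (agent k) then W a a else 0
  | post t a => if Nat.eqb t (S k) && Nat.eqb a (agent k) then 1 else 0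
  end.

Lemma x_state_S k l : x_state (S k) l =
  cadd (xstep k (x_state k l)) (cscale (- (gamma k * direction k l)) (x_unit k)).
Proof.
  apply functional_extensionality; intros [a|t a];
    unfold cadd, cscale; cbn [avg_step x_state x_unit].
  - rewrite sx_S. destruct (Nat.eqb_spec a (agent k)) as [->|]; [|ring].
    rewrite (rsum_ext V _ (fun j => W (agent k) j *
      (if E j (agent k) then sv (run k) (Z.of_nat (src k j)) j l
       else sx (run k) (agent k) l)))
      by (intros j _; unfold source; destruct (E j (agent k)); reflexivity).
    rewrite (weights_average V E mbar W) by auto.
    rewrite xnew_eq. unfold vadd, vscale, vsub, vsum.
    rewrite (rsum_ext V (fun j => (if E j (agent k) then _ else _) l)
      (fun j => if E j (agent k)
        then W (agent k) j * sv (run k) (Z.of_nat (src k j)) j l else 0)); [ring|].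
    intros j _. destruct (E j (agent k)); [|reflexivity].
    rewrite sv_truncate. reflexivity.
  - rewrite sv_S. destruct (Nat.eqb_spec t (S k)) as [->|].
    + destruct (Z.eqb_spec (Z.of_nat (S k)) (Z.of_nat k + 1)); [|lia].
      destruct (Nat.eqb_spec a (agent k)) as [->|]; unfold vsub, vscale; simpl; ring.
    + destruct (Z.eqb_spec (Z.of_nat t) (Z.of_nat k + 1)); [lia|]. simpl; ring.
Qed.

Lemma x_unit_range k c : visible V D (S k) c -> 0 <= x_unit k c <= 1.
Proof.
  destruct c as [a|t a]; simpl; [|destruct (_ && _); lra].
  intros a_lt. destruct (Nat.eqb a (agent k)); [|lra].
  split; [apply (weights_nonneg V E mbar); auto; lra|].
  rewrite <- (W_row_sum a a_lt). apply (rsum_term_le V (W a)); [|exact a_lt].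
  intros j j_lt. apply (weights_nonneg V E mbar); auto; lra.
Qed.

Definition x_move (k : nat) : R := gamma k * norm n (direction k).

Lemma x_move_nonneg k : 0 <= x_move k.
Proof. apply Rmult_le_pos; [apply gamma_nonneg | apply norm_nonneg]. Qed.

Lemma x_perturbation_spread k l : (l < n)%nat ->
  spread V D (S k) (cscale (- (gamma k * direction k l)) (x_unit k)) (x_move k).
Proof.
  intros l_lt. apply spread_mono with (Rabs (- (gamma k * direction k l))).
  - rewrite Rabs_Ropp, Rabs_mult, (Rabs_pos_eq (gamma k)) by apply gamma_nonneg.
    apply Rmult_le_compat_l; [apply gamma_nonneg | apply coord_le_norm, l_lt].
  - apply spread_scale, x_unit_range.
Qed.

Lemma x_initial_spread : exists b, 0 <= b /\
  forall l, (l < n)%nat -> spread V D 0 (x_state 0 l) b.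
Proof.
  set (b := rsum V (fun a => norm n (x0 a))).
  assert (b_nonneg : 0 <= b) by (apply rsum_nonneg; intros; apply norm_nonneg).
  exists (2 * b). split; [lra|]. intros l l_lt. exists (- b).
  intros [a|t a] c_visible; unfold x_state; rewrite run_0; simpl; [|unfold vzero; lra].
  assert (Rabs (x0 a l) <= b).
  { eapply Rle_trans; [apply coord_le_norm, l_lt|].
    apply (rsum_term_le V (fun a => norm n (x0 a))); [|exact c_visible].
    intros; apply norm_nonneg. }
  pose proof (Rle_abs (x0 a l)). pose proof (Rle_abs (- x0 a l)) as neg_le.
  rewrite Rabs_Ropp in neg_le. lra.
Qed.

(* The value of agent [a] after [s] further iterations, if all step sizes vanished from
   time [k] on. *)
Definition forecast (k s a : nat) : vec :=
  fun l => evolve xstep k s (x_state k l) (own a).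

Definition consensus (k : nat) (r : R) : Prop := forall s a b, (a < V)%nat -> (b < V)%nat ->
  norm n (vsub (forecast k s a) (sx (run k) b)) <= r.

Lemma spread_consensus k r : 0 <= r ->
  (forall l, (l < n)%nat -> spread V D k (x_state k l) r) -> consensus k (sqrt (INR n) * r).
Proof.
  intros r_nonneg x_spread s a b a_lt b_lt. apply norm_le_coords; [exact r_nonneg|].
  intros l l_lt.
  apply (avg_evolve_near V D E W mbar agent src) with (c := own b);
    auto using src_window.
Qed.

Lemma consensus_error : exists rho c r, 0 < rho < 1 /\ (forall k : nat, 0 <= r k) /\
  (forall k, r (S k) = rho * r k + c * x_move k) /\ (forall k, consensus k (r k)).
Proof.
  destruct (avg_stable V T D E W mbar agent src) as (rho & c & rho_range & c_pos & bound);
    auto using src_window.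
  destruct x_initial_spread as (b & b_nonneg & initial).
  set (r := discounted rho c b x_move).
  assert (r_nonneg : forall k, 0 <= r k)
    by (intros; apply discounted_nonneg; auto using x_move_nonneg; lra).
  exists rho, (sqrt (INR n) * c), (fun k => sqrt (INR n) * r k).
  split; [exact rho_range|]. split; [|split].
  - intros k. apply Rmult_le_pos; [apply sqrt_pos | apply r_nonneg].
  - intros k. unfold r; simpl. ring.
  - intros k. apply spread_consensus; [apply r_nonneg|]. intros l l_lt.
    apply (bound (fun k => x_state k l)
      (fun k => cscale (- (gamma k * direction k l)) (x_unit k)));
      auto using x_move_nonneg, x_state_S, x_perturbation_spread.
Qed.

(** ** The mass-splitting system *)

Definition sent (a j l t : nat) : R :=
  if Nat.eqb (agent t) j then A a j * zhalf t l else 0.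

Definition pending (k l t a : nat) : R :=
  if Nat.ltb t k && E (agent t) a && Nat.leb (read_time k a (agent t)) t
  then A a (agent t) * zhalf t l else 0.

Definition z_state (k l : nat) : config := fun c =>
  match c with own a => sz (run k) a l | post t a => pending k l t a end.

Lemma srho_sum k s a j l : E j a = true -> (s <= k)%nat ->
  srho (run k) (Z.of_nat s) a j l = rsum s (sent a j l).
Proof.
  intros edge. revert s. induction k as [|k IH]; intros s s_le.
  - assert (s = O) as -> by lia. rewrite run_0; reflexivity.
  - rewrite srho_S. destruct (Z.eqb_spec (Z.of_nat s) (Z.of_nat k + 1)); [|apply IH; lia].
    assert (s = S k) as -> by lia. simpl rsum. rewrite <- IH by lia. unfold sent.
    rewrite (Nat.eqb_sym (agent k) j).
    destruct (Nat.eqb_spec j (agent k)) as [->|]; simpl; [|ring].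
    rewrite edge. reflexivity.
Qed.

Lemma srt_sum k a j l : E j a = true ->
  srt (run k) a j l = rsum (read_time k a j) (sent a j l).
Proof.
  intros edge. induction k as [|k IH].
  - rewrite read_time_0, run_0. reflexivity.
  - rewrite srt_S. destruct (Nat.eqb_spec a (agent k)) as [->|inactive]; simpl.
    + rewrite edge, srho_truncate. apply srho_sum; [exact edge | apply read_time_S_le].
    + rewrite read_time_inactive by assumption. exact IH.
Qed.

Lemma received_on_edge k j l :
  (if E j (agent k)
   then vsub (srho (run k) (stau (run (S k)) (agent k) j) (agent k) j) (srt (run k) (agent k) j)
   else vzero) l
  = rsum k (fun t => if Nat.eqb j (agent t)
                     then (if rcv k t then pending k l t (agent k) else 0) else 0).
Proof.
  destruct (E j (agent k)) eqn:edge.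
  - unfold vsub. rewrite srho_truncate, srho_sum by (auto; apply read_time_S_le).
    rewrite srt_sum by exact edge. fold (read_time (S k) (agent k) j).
    rewrite <- (rsum_window k) by (apply read_time_mono || apply read_time_S_le).
    apply rsum_ext. intros t t_lt. unfold sent. rewrite (Nat.eqb_sym (agent t) j).
    destruct (Nat.eqb_spec j (agent t)) as [->|]; [|destruct (_ && _); reflexivity].
    unfold rcv, pending, src. rewrite edge. destruct (Nat.ltb_spec t k); [|lia].
    simpl. destruct (Nat.leb _ _), (Nat.ltb _ _); reflexivity.
  - symmetry. apply rsum_eq_0. intros t _.
    destruct (Nat.eqb_spec j (agent t)) as [->|]; [|reflexivity].
    unfold pending. rewrite edge, andb_false_r. destruct (rcv k t); reflexivity.
Qed.

Lemma zhalf_gathered k l :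
  zhalf k l = gathered agent rcv k (z_state k l) + grad_change k l.
Proof.
  unfold zhalf, gathered, vadd, vsum; cbn [z_state].
  rewrite (rsum_ext V _ _ (fun j _ => received_on_edge k j l)), rsum_exchange.
  do 2 f_equal. apply rsum_ext. intros t _. apply rsum_indicator, agent_lt.
Qed.

Lemma pending_S k l t a : (t < k)%nat ->
  pending (S k) l t a = if Nat.eqb a (agent k) && rcv k t then 0 else pending k l t a.
Proof.
  intros t_lt. unfold pending.
  destruct (Nat.ltb_spec t (S k)), (Nat.ltb_spec t k); try lia; simpl.
  destruct (Nat.eqb_spec a (agent k)) as [->|inactive]; simpl.
  - unfold rcv. destruct (E (agent t) (agent k)); simpl; [|reflexivity].
    pose proof (read_time_mono k (agent k) (agent t)). unfold src.
    destruct (Nat.ltb_spec t (read_time (S k) (agent k) (agent t)));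
    destruct (Nat.leb_spec (read_time (S k) (agent k) (agent t)) t);
    destruct (Nat.leb_spec (read_time k (agent k) (agent t)) t); try reflexivity; lia.
  - rewrite read_time_inactive by assumption. reflexivity.
Qed.

Lemma pending_future k l t a : (k <= t)%nat -> pending k l t a = 0.
Proof. intros k_le. unfold pending. destruct (Nat.ltb_spec t k); [lia | reflexivity]. Qed.

Lemma z_state_S k l : z_state (S k) l =
  cadd (zstep k (z_state k l)) (cscale (grad_change k l) (split_unit E A agent k)).
Proof.
  apply functional_extensionality; intros [a|t a];
    unfold cadd, cscale; cbn [split_step split_unit z_state].
  - rewrite sz_S. destruct (Nat.eqb_spec a (agent k)) as [->|]; [|ring].
    unfold vscale. rewrite zhalf_gathered. ring.
  - destruct (Nat.eqb_spec t k) as [->|]; simpl.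
    + unfold pending. destruct (Nat.ltb_spec k (S k)); [|lia].
      pose proof (read_time_S_le k a (agent k)).
      destruct (Nat.leb_spec (read_time (S k) a (agent k)) k); [|lia].
      destruct (E (agent k) a); simpl; [|ring]. rewrite zhalf_gathered. ring.
    + rewrite Rmult_0_r, Rplus_0_r. destruct (Nat.lt_ge_cases t k).
      * apply pending_S; assumption.
      * rewrite !pending_future by lia. destruct (_ && _); reflexivity.
Qed.

Definition grad_sum (k : nat) : vec := vsum V (fun a => g a (sx (run k) a)).

Lemma grad_sum_S k l : grad_sum (S k) l = grad_sum k l + grad_change k l.
Proof.
  unfold grad_sum, vsum.
  rewrite <- (rsum_indicator V (agent k) (grad_change k l)), <- rsum_plus by apply agent_lt.
  apply rsum_ext. intros a _. rewrite sx_S.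
  destruct (Nat.eqb_spec a (agent k)) as [->|]; unfold grad_change, vsub; ring.
Qed.

Lemma mass_z_state k l : mass V k (z_state k l) = grad_sum k l.
Proof.
  induction k as [|k IH].
  - apply rsum_ext. intros a _. unfold holding; simpl. rewrite run_0; simpl. ring.
  - rewrite z_state_S, mass_add, mass_scale.
    rewrite (mass_split_step V E A mbar), (mass_split_unit V E A mbar) by assumption.
    rewrite IH, grad_sum_S. ring.
Qed.

(* The proportion of the total mass held by each agent, had it been uniform initially. *)
Definition share (k : nat) : config :=
  evolve zstep 0 k (fun c => match c with own _ => / INR V | post _ _ => 0 end).

Lemma share_nonneg k : mass_nonneg V k (share k).
Proof.
  apply (split_evolve_nonneg V E A mbar agent rcv) with (k := O); auto.
  intros [a|t a] _; simpl; [|lra]. apply Rlt_le, Rinv_0_lt_compat, lt_0_INR, V_pos.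
Qed.

Lemma share_mass k : mass V k (share k) = 1.
Proof.
  transitivity (mass V 0 (share 0));
    [apply (mass_split_evolve V E A mbar agent rcv) with (k := O); assumption|].
  unfold mass, holding, share; simpl.
  rewrite (rsum_ext V _ (fun _ => / INR V)) by (intros; ring).
  rewrite rsum_const. apply Rinv_r, not_0_INR; lia.
Qed.

Definition z_error (k l : nat) : config :=
  cadd (z_state k l) (cscale (- grad_sum k l) (share k)).

Definition z_perturbation (k l : nat) : config :=
  cscale (grad_change k l) (cadd (split_unit E A agent k) (cscale (-1) (share (S k)))).

Lemma z_error_S k l : z_error (S k) l = cadd (zstep k (z_error k l)) (z_perturbation k l).
Proof.
  unfold z_error, z_perturbation.
  rewrite (linear_add _ (split_step_linear E A agent rcv k)),
    (linear_scale _ (split_step_linear E A agent rcv k)), z_state_S, grad_sum_S.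
  change (zstep k (share k)) with (share (S k)).
  apply functional_extensionality; intros c. unfold cadd, cscale; ring.
Qed.

Lemma z_perturbation_balanced k l : (l < n)%nat ->
  balanced V (S k) (z_perturbation k l) (2 * norm n (grad_change k)).
Proof.
  intros l_lt.
  assert (unit_balanced : balanced V (S k)
    (cadd (split_unit E A agent k) (cscale (-1) (share (S k)))) (2 * 1)).
  { apply balanced_sub.
    - apply (split_unit_nonneg V E A mbar agent); assumption.
    - apply share_nonneg.
    - apply (mass_split_unit V E A mbar agent); assumption.
    - apply share_mass. }
  destruct (balanced_scale V (S k) (grad_change k l) _ _ unit_balanced) as [mass_0 mass_le].
  split; [exact mass_0|].
  pose proof (coord_le_norm n (grad_change k) l l_lt). unfold z_perturbation. lra.
Qed.

Lemma z_initial_balanced : exists b, 0 <= b /\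
  forall l, (l < n)%nat -> balanced V 0 (z_error 0 l) b.
Proof.
  assert (mass_abs_nonneg : forall l, 0 <= mass V 0 (cabs (z_error 0 l))).
  { intros l. eapply Rle_trans; [|apply own_le_mass with (a := O)];
      [apply cabs_nonneg with (V := V) (k := O) | apply cabs_nonneg |]; exact V_pos. }
  exists (rsum n (fun l => mass V 0 (cabs (z_error 0 l)))).
  split; [apply rsum_nonneg; auto|]. intros l l_lt. split.
  - unfold z_error. rewrite mass_add, mass_scale, mass_z_state, share_mass. ring.
  - apply (rsum_term_le n (fun l => mass V 0 (cabs (z_error 0 l)))); auto.
Qed.

Definition tracking (k : nat) (q : R) : Prop :=
  norm n (vsub (direction k) (vscale (share k (own (agent k))) (grad_sum k))) <= q.

Lemma balanced_tracking k q : 0 <= q ->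
  (forall l, (l < n)%nat -> balanced V k (z_error k l) q) -> tracking k (sqrt (INR n) * q).
Proof.
  intros q_nonneg error_balanced. apply norm_le_coords; [exact q_nonneg|]. intros l l_lt.
  pose proof (balanced_own_le V k _ q (agent k) (error_balanced l l_lt) (agent_lt k))
    as error_le.
  unfold vsub, vscale, direction. unfold z_error, cadd, cscale in error_le; simpl in error_le.
  replace (sz (run k) (agent k) l - share k (own (agent k)) * grad_sum k l)
    with (sz (run k) (agent k) l + - grad_sum k l * share k (own (agent k))) by ring.
  exact error_le.
Qed.

Lemma tracking_error : exists rho c q, 0 < rho < 1 /\ (forall k : nat, 0 <= q k) /\
  (forall k, q (S k) = rho * q k + c * norm n (grad_change k)) /\
  (forall k, tracking k (q k)).
Proof.
  destruct (split_stable V T D E A mbar agent rcv)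
    as (rho & c & rho_range & c_pos & bound); auto using rcv_old.
  destruct z_initial_balanced as (b & b_nonneg & initial).
  set (e := fun k => 2 * norm n (grad_change k)).
  assert (e_nonneg : forall k, 0 <= e k)
    by (intros k; pose proof (norm_nonneg n (grad_change k)); unfold e; lra).
  set (q := discounted rho c b e).
  assert (q_nonneg : forall k, 0 <= q k) by (intros; apply discounted_nonneg; auto; lra).
  exists rho, (sqrt (INR n) * c * 2), (fun k => sqrt (INR n) * q k).
  split; [exact rho_range|]. split; [|split].
  - intros k. apply Rmult_le_pos; [apply sqrt_pos | apply q_nonneg].
  - intros k. unfold q, e; simpl. ring.
  - intros k. apply balanced_tracking; [apply q_nonneg|]. intros l l_lt.
    apply (bound (fun k => z_error k l) (fun k => z_perturbation k l));
      unfold e; auto using z_error_S, z_perturbation_balanced.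
Qed.

Lemma share_range : exists eta N, 0 < eta /\ forall k i, (i < V)%nat -> (N <= k)%nat ->
  eta <= share k (own i) <= 1.
Proof.
  destruct (split_positivity V T D E A mbar agent rcv)
    as (N & eta & _ & eta_range & positivity); auto using rcv_old.
  exists eta, N. split; [lra|]. intros k i i_lt N_le. split.
  - specialize (positivity (k - N)%nat (share (k - N)) i i_lt (share_nonneg _)).
    rewrite share_mass, Rmult_1_r in positivity. unfold share in *.
    change (k - N)%nat with (0 + (k - N))%nat in positivity at 1.
    rewrite <- evolve_add in positivity.
    replace (k - N + N)%nat with k in positivity by lia. exact positivity.
  - rewrite <- (share_mass k). apply own_le_mass; [apply share_nonneg | exact i_lt].
Qed.

(** ** Descent of the objective *)

Definition Lsum : R := rsum V (fun i => Rabs (L i)).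
Definition objective (x : vec) : R := rsum V (fun i => f i x).
Definition gradient (x : vec) : vec := vsum V (fun i => g i x).

Lemma Lsum_nonneg : 0 <= Lsum.
Proof. apply rsum_nonneg; intros; apply Rabs_pos. Qed.

Lemma g_lipschitz_Lsum i : (i < V)%nat -> lipschitz n Lsum (g i).
Proof.
  intros i_lt x y. eapply Rle_trans; [apply g_lipschitz, i_lt|].
  apply Rmult_le_compat_r; [apply norm_nonneg|].
  eapply Rle_trans; [apply Rle_abs|].
  apply (rsum_term_le V (fun i => Rabs (L i))); [intros; apply Rabs_pos | exact i_lt].
Qed.

Lemma gradients_near (x : nat -> vec) y r :
  (forall i, (i < V)%nat -> norm n (vsub (x i) y) <= r) ->
  norm n (vsub (vsum V (fun i => g i (x i))) (gradient y)) <= Lsum * r.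
Proof.
  intros x_near.
  replace (vsub (vsum V (fun i => g i (x i))) (gradient y))
    with (vsum V (fun i => vsub (g i (x i)) (g i y)))
    by (apply functional_extensionality; intros l; apply rsum_minus).
  eapply Rle_trans; [apply norm_vsum|]. unfold Lsum.
  rewrite Rmult_comm, <- rsum_scal. apply rsum_le. intros i i_lt.
  eapply Rle_trans; [apply g_lipschitz, i_lt|]. rewrite (Rmult_comm r).
  apply Rle_trans with (Rabs (L i) * norm n (vsub (x i) y)).
  - apply Rmult_le_compat_r; [apply norm_nonneg | apply Rle_abs].
  - apply Rmult_le_compat_l; [apply Rabs_pos | apply x_near, i_lt].
Qed.

Lemma objective_descent y h :
  objective (vadd y h) <= objective y + inner n (gradient y) h + Lsum * sqnorm n h.
Proof.
  unfold objective, gradient, Lsum. rewrite inner_vsum_l.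
  rewrite (Rmult_comm _ (sqnorm n h)), <- rsum_scal, <- !rsum_plus.
  apply rsum_le. intros i i_lt. rewrite (Rmult_comm (sqnorm n h)).
  apply descent_inequality; [apply f_gradient | apply g_lipschitz]; exact i_lt.
Qed.

Definition center (K k : nat) : vec := forecast k (K - k) O.

Definition center_weight (K k : nat) : R :=
  evolve xstep (S k) (K - S k) (x_unit k) (own O).

Lemma center_S K k : (k < K)%nat ->
  center K (S k) = vadd (center K k) (vscale (- (gamma k * center_weight K k)) (direction k)).
Proof.
  intros k_lt. apply functional_extensionality; intros l.
  unfold center, center_weight, forecast, vadd, vscale.
  pose proof (avg_evolve_linear V E W agent src (S k) (K - S k)) as evolve_lin.
  rewrite x_state_S, (linear_add _ evolve_lin), (linear_scale _ evolve_lin).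
  replace (K - k)%nat with (S (K - S k)) by lia. rewrite evolve_S_first.
  unfold cadd, cscale; ring.
Qed.

Lemma center_weight_range : exists eta N, 0 < eta /\
  forall K k, (k + N < K)%nat -> eta <= center_weight K k <= 1.
Proof.
  destruct (avg_positivity V T D E W mbar agent src) as (N & _ & positivity);
    auto using src_window.
  exists (mbar ^ N * mbar), N.
  split; [apply Rmult_lt_0_compat; [apply pow_lt|]; lra|]. intros K k k_lt.
  assert (range : forall s lo hi h,
    (forall c, visible V D (S k + N) c -> lo <= h c <= hi) ->
    lo <= evolve xstep (S k + N) s h (own O) <= hi).
  { intros s lo hi h h_range.
    apply (avg_evolve_range V D E W mbar agent src); auto using src_window. }
  unfold center_weight. replace (K - S k)%nat with (N + (K - S k - N))%nat by lia.
  rewrite evolve_add. apply range. intros c c_visible. split.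
  - apply Rle_trans with (mbar ^ N * x_unit k (own (agent k))).
    + apply Rmult_le_compat_l; [apply pow_le; lra|]. simpl. rewrite Nat.eqb_refl.
      apply (diagonal_weight _ _ _ _ W_weights), agent_lt.
    + apply positivity; [apply agent_lt | | exact c_visible].
      intros c' c'_visible. apply x_unit_range, c'_visible.
  - apply (avg_evolve_range V D E W mbar agent src) with (k := S k) (lo := 0);
      auto using src_window, x_unit_range.
Qed.

Lemma xnew_near k r : consensus k r ->
  norm n (vsub (xnew k) (sx (run k) (agent k))) <= r + x_move k.
Proof.
  intros x_consensus.
  assert (xnew_forecast : xnew k = vadd (forecast k 1 (agent k))
            (vscale (- (gamma k * W (agent k) (agent k))) (direction k))).
  { apply functional_extensionality; intros l.
    change (xnew k l) with (x_state (S k) l (own (agent k))). rewrite x_state_S.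
    unfold cadd, cscale, vadd, vscale, forecast. rewrite evolve_1.
    simpl x_unit. rewrite Nat.eqb_refl. ring. }
  replace (vsub (xnew k) (sx (run k) (agent k)))
    with (vadd (vsub (forecast k 1 (agent k)) (sx (run k) (agent k)))
            (vscale (- (gamma k * W (agent k) (agent k))) (direction k)))
    by (rewrite xnew_forecast; vec_ring).
  eapply Rle_trans; [apply norm_vadd|].
  apply Rplus_le_compat; [apply x_consensus; apply agent_lt|].
  pose proof (x_unit_range k (own (agent k)) (agent_lt k)) as weight_range.
  simpl in weight_range. rewrite Nat.eqb_refl in weight_range.
  pose proof (gamma_nonneg k).
  rewrite norm_vscale, Rabs_Ropp, Rabs_pos_eq by (apply Rmult_le_pos; lra).
  unfold x_move. apply Rmult_le_compat_r; [apply norm_nonneg | nra].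
Qed.

Lemma objective_center_S K k : (k < K)%nat -> 0 <= center_weight K k <= 1 ->
  objective (center K (S k))
  <= objective (center K k)
     - gamma k * center_weight K k * inner n (gradient (center K k)) (direction k)
     + Lsum * (x_move k)².
Proof.
  intros k_lt weight_range. set (b := gamma k * center_weight K k).
  pose proof (gamma_nonneg k).
  assert (b_range : 0 <= b <= gamma k) by (unfold b; nra).
  rewrite center_S by exact k_lt. fold b.
  eapply Rle_trans; [apply objective_descent|].
  rewrite inner_vscale_r, <- norm_sqr, norm_vscale, Rabs_Ropp, Rabs_pos_eq by lra.
  assert ((b * norm n (direction k))² <= (x_move k)²).
  { pose proof (norm_nonneg n (direction k)).
    apply Rsqr_incr_1; unfold x_move; [apply Rmult_le_compat_r | |]; nra. }
  assert (Lsum * (b * norm n (direction k))² <= Lsum * (x_move k)²)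
    by (apply Rmult_le_compat_l; [apply Lsum_nonneg | assumption]).
  lra.
Qed.

Section ErrorBounds.

Variables (rho_x c_x rho_z c_z : R) (r q : nat -> R).
Hypothesis rho_x_range : 0 < rho_x < 1.
Hypothesis rho_z_range : 0 < rho_z < 1.
Hypothesis r_nonneg : forall k, 0 <= r k.
Hypothesis q_nonneg : forall k, 0 <= q k.
Hypothesis r_S : forall k, r (S k) = rho_x * r k + c_x * x_move k.
Hypothesis q_S : forall k, q (S k) = rho_z * q k + c_z * norm n (grad_change k).
Hypothesis consensus_r : forall k, consensus k (r k).
Hypothesis tracking_q : forall k, tracking k (q k).

Definition direction_error (k : nat) : R := Lsum * r k + q k.
Definition center_grad (K k : nat) : R := norm n (gradient (center K k)).

Lemma agent_near_center K k i : (i < V)%nat ->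
  norm n (vsub (sx (run k) i) (center K k)) <= r k.
Proof. intros i_lt. rewrite norm_vsub_comm. apply consensus_r; assumption. Qed.

Lemma direction_error_nonneg k : 0 <= direction_error k.
Proof.
  apply Rplus_le_le_0_compat; [apply Rmult_le_pos; [apply Lsum_nonneg|]|]; auto.
Qed.

Lemma grad_change_le k : norm n (grad_change k) <= Lsum * (r k + x_move k).
Proof.
  eapply Rle_trans; [apply g_lipschitz_Lsum, agent_lt|].
  apply Rmult_le_compat_l; [apply Lsum_nonneg | apply xnew_near, consensus_r].
Qed.

Lemma direction_near_gradient K k (xi := share k (own (agent k))) : 0 <= xi <= 1 ->
  norm n (vsub (direction k) (vscale xi (gradient (center K k)))) <= direction_error k.
Proof.
  intros xi_range.
  replace (vsub (direction k) (vscale xi (gradient (center K k))))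
    with (vadd (vscale xi (vsub (grad_sum k) (gradient (center K k))))
               (vsub (direction k) (vscale xi (grad_sum k)))) by vec_ring.
  eapply Rle_trans; [apply norm_vadd|].
  apply Rplus_le_compat; [|apply tracking_q].
  pose proof (gradients_near (sx (run k)) (center K k) (r k)
                (fun i => agent_near_center K k i)) as near.
  change (vsum V (fun i => g i (sx (run k) i))) with (grad_sum k) in near.
  pose proof (norm_nonneg n (vsub (grad_sum k) (gradient (center K k)))).
  rewrite norm_vscale, Rabs_pos_eq by lra. nra.
Qed.

Lemma direction_le K k : 0 <= share k (own (agent k)) <= 1 ->
  norm n (direction k) <= center_grad K k + direction_error k.
Proof.
  intros xi_range. pose proof (direction_near_gradient K k xi_range).
  eapply Rle_trans;
    [apply norm_le_via with (v := vscale (share k (own (agent k))) (gradient (center K k)))|].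
  rewrite norm_vscale, Rabs_pos_eq by lra.
  pose proof (norm_nonneg n (gradient (center K k))). unfold center_grad. nra.
Qed.

Lemma direction_descends K k eta : 0 <= eta -> eta <= share k (own (agent k)) <= 1 ->
  eta * (center_grad K k)² - center_grad K k * direction_error k
  <= inner n (gradient (center K k)) (direction k).
Proof.
  intros eta_nonneg xi_range. pose proof (direction_near_gradient K k ltac:(lra)) as near.
  set (xi := share k (own (agent k))) in *.
  set (y := gradient (center K k)) in *. set (w := vsub (direction k) (vscale xi y)) in *.
  replace (direction k) with (vadd (vscale xi y) w) by (unfold w; vec_ring).
  rewrite inner_vadd_r, inner_vscale_r.
  change (inner n y y) with (sqnorm n y). rewrite <- norm_sqr.
  unfold center_grad. fold y. pose proof (norm_nonneg n y) as y_nonneg.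
  assert (eta * (norm n y)² <= xi * (norm n y)²)
    by (apply Rmult_le_compat_r; [apply Rle_0_sqr | lra]).
  pose proof (cauchy_schwarz n (vscale (-1) y) w) as below.
  rewrite inner_vscale_l, norm_vscale, Rabs_left in below by lra.
  pose proof (Rmult_le_compat_l _ _ _ y_nonneg near). lra.
Qed.

Lemma objective_center_decrease K k beta eta :
  (k < K)%nat -> 0 < beta -> 0 < eta ->
  beta <= center_weight K k <= 1 -> eta <= share k (own (agent k)) <= 1 ->
  objective (center K (S k))
  <= objective (center K k) - beta * eta / 2 * (gamma k * (center_grad K k)²)
     + / (2 * eta) * (gamma k * (direction_error k)²) + Lsum * (x_move k)².
Proof.
  intros k_lt beta_pos eta_pos weight_range xi_range.
  eapply Rle_trans; [apply objective_center_S; [exact k_lt | lra]|].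
  pose proof (descent_term_ge (gamma k) (center_weight K k) beta eta (center_grad K k)
    (direction_error k) (inner n (gradient (center K k)) (direction k)) (gamma_nonneg k)
    ltac:(lra) ltac:(lra) eta_pos (direction_descends K k eta ltac:(lra) xi_range)).
  lra.
Qed.

Definition potential (omega : R) (K k : nat) : R :=
  objective (center K k) + omega * (r k)² + (q k)².

Definition descent_rate (K k : nat) : R := gamma k * (center_grad K k)² + (r k)².

Lemma sqr_r_S k : (r (S k))² <= rho_x * (r k)² + c_x² / (1 - rho_x) * (x_move k)².
Proof. rewrite r_S. apply sqr_contraction_le, rho_x_range. Qed.

Lemma sqr_q_S k : (q (S k))²
  <= rho_z * (q k)² + c_z² / (1 - rho_z) * (2 * Lsum²) * ((r k)² + (x_move k)²).
Proof.
  rewrite q_S. eapply Rle_trans; [apply sqr_contraction_le, rho_z_range|].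
  apply Rplus_le_compat_l. rewrite Rmult_assoc. apply Rmult_le_compat_l.
  { apply Rmult_le_pos; [apply Rle_0_sqr | apply Rlt_le, Rinv_0_lt_compat; lra]. }
  apply Rle_trans with (Lsum * (r k + x_move k))².
  - apply Rsqr_incr_1; [apply grad_change_le | apply norm_nonneg |].
    eapply Rle_trans; [apply norm_nonneg | apply grad_change_le].
  - rewrite Rsqr_mult. pose proof (sqr_add_le (r k) (x_move k)).
    pose proof (Rle_0_sqr Lsum). nra.
Qed.

Lemma sqr_direction_error_le k :
  (direction_error k)² <= (2 * Lsum² + 2) * ((r k)² + (q k)²).
Proof.
  unfold direction_error. eapply Rle_trans; [apply sqr_add_le|]. rewrite Rsqr_mult.
  pose proof (Rmult_le_pos _ _ (Rle_0_sqr Lsum) (Rle_0_sqr (q k))).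
  pose proof (Rle_0_sqr (r k)). lra.
Qed.

Lemma sqr_x_move_le K k : 0 <= share k (own (agent k)) <= 1 ->
  (x_move k)² <= 2 * (gamma k)² * ((center_grad K k)² + (direction_error k)²).
Proof.
  intros xi_range. unfold x_move. rewrite Rsqr_mult.
  assert ((norm n (direction k))² <= (center_grad K k + direction_error k)²).
  { apply Rsqr_incr_1; [apply direction_le, xi_range | apply norm_nonneg |].
    apply Rplus_le_le_0_compat; [apply norm_nonneg | apply direction_error_nonneg]. }
  pose proof (sqr_add_le (center_grad K k) (direction_error k)).
  pose proof (Rle_0_sqr (gamma k)). nra.
Qed.

Lemma potential_decrease : exists omega mu k0 N, 0 <= omega /\ 0 < mu /\
  forall K k, (k0 <= k)%nat -> (k + N < K)%nat ->
    gamma k <= 1 /\ potential omega K (S k) <= potential omega K k - mu * descent_rate K k.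
Proof.
  destruct center_weight_range as (beta & N & beta_pos & weight_range).
  destruct share_range as (eta & k_share & eta_pos & xi_range).
  set (d_x := c_x² / (1 - rho_x)). set (d_z := c_z² / (1 - rho_z) * (2 * Lsum²)).
  pose proof (Rle_0_sqr Lsum).
  assert (d_x_nonneg : 0 <= d_x) by (apply Rle_mult_inv_pos; [apply Rle_0_sqr | lra]).
  assert (d_z_nonneg : 0 <= d_z)
    by (apply Rmult_le_pos; [apply Rle_mult_inv_pos; [apply Rle_0_sqr | lra] | lra]).
  assert (kappa_pos : 0 < beta * eta / 2)
    by (pose proof (Rmult_lt_0_compat _ _ beta_pos eta_pos); lra).
  assert (nu_pos : 0 < / (2 * eta)) by (apply Rinv_0_lt_compat; lra).
  destruct (lyapunov_threshold rho_x d_x rho_z d_z (beta * eta / 2) (/ (2 * eta)) Lsum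
              (2 * Lsum² + 2)) as (gam_max & gam_max_range & small_enough);
    auto using Lsum_nonneg; try lra.
  destruct (gamma_cv_0 gam_max) as [k_small gamma_small]; [lra|].
  exists (consensus_weight rho_x d_z), (Rmin (beta * eta / 2 / 2) 1), (k_small + k_share)%nat, N.
  split; [apply consensus_weight_nonneg; assumption|].
  split; [apply Rmin_pos; lra|]. intros K k k_ge k_lt.
  assert (gamma_range : 0 <= gamma k <= gam_max).
  { pose proof (gamma_nonneg k). specialize (gamma_small k ltac:(lia)).
    unfold Rdist in gamma_small. rewrite Rminus_0_r, Rabs_pos_eq in gamma_small by lra. lra. }
  specialize (weight_range K k k_lt).
  specialize (xi_range k (agent k) (agent_lt k) ltac:(lia)).
  destruct (small_enough (gamma k) gamma_range) as [move_small dir_small].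
  split; [lra|]. apply lyapunov_step with (d_x := d_x) (rho_z := rho_z) (nu := / (2 * eta))
    (L := Lsum) (P := 2 * Lsum² + 2) (dir2 := (direction_error k)²) (move2 := (x_move k)²);
    auto using Lsum_nonneg, Rle_0_sqr, sqr_direction_error_le, sqr_r_S, sqr_q_S; try lra.
  - apply sqr_x_move_le; lra.
  - apply objective_center_decrease; [lia | assumption..].
Qed.

Lemma objective_center_bounded k : exists upper, forall K, objective (center K k) <= upper.
Proof.
  set (y := sx (run k) O).
  exists (objective y + norm n (gradient y) * r k + Lsum * (r k)²). intros K.
  set (h := vsub (center K k) y).
  replace (center K k) with (vadd y h) by (unfold h; vec_ring).
  assert (h_le : norm n h <= r k) by (apply consensus_r; exact V_pos).
  pose proof (objective_descent y h). pose proof (cauchy_schwarz n (gradient y) h).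
  pose proof (Rmult_le_compat_l _ _ _ (norm_nonneg n (gradient y)) h_le).
  assert (sqnorm n h <= (r k)²)
    by (rewrite <- norm_sqr; apply Rsqr_incr_1; auto using norm_nonneg).
  pose proof (Rmult_le_compat_l Lsum _ _ Lsum_nonneg ltac:(eassumption)). lra.
Qed.

Lemma potential_bounded_below omega : 0 <= omega ->
  exists lower, forall K k, lower <= potential omega K k.
Proof.
  intros omega_nonneg. destruct objective_bounded_below as [lower lower_le].
  exists lower. intros K k. unfold potential.
  pose proof (lower_le (center K k) : lower <= objective (center K k)).
  pose proof (Rmult_le_pos _ _ omega_nonneg (Rle_0_sqr (r k))). pose proof (Rle_0_sqr (q k)). lra.
Qed.

Definition merit_constant : R := 2 + 2 * Lsum² + INR V.

Lemma merit_constant_pos : 0 < merit_constant.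
Proof. unfold merit_constant. pose proof (Rle_0_sqr Lsum). pose proof (pos_INR V). lra. Qed.

Lemma xbar_near_center K k : norm n (vsub (xbar V (sx (run k))) (center K k)) <= r k.
Proof.
  apply xbar_near; [exact V_pos|]. intros; apply agent_near_center; assumption.
Qed.

Lemma agent_near_xbar k i : (i < V)%nat ->
  norm n (vsub (sx (run k) i) (xbar V (sx (run k)))) <= r k.
Proof.
  intros i_lt. rewrite norm_vsub_comm. apply xbar_near; [exact V_pos|].
  intros j j_lt. apply (consensus_r k O j i); assumption.
Qed.

Lemma merit_le K k :
  merit n V g (sx (run k)) <= merit_constant * ((center_grad K k)² + (r k)²).
Proof.
  unfold merit, merit_constant. set (xb := xbar V (sx (run k))).
  pose proof (Rle_0_sqr (center_grad K k)) as G_nonneg.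
  pose proof (Rle_0_sqr (r k)) as rr_nonneg. pose proof (Rle_0_sqr Lsum) as L_nonneg.
  pose proof (Rmult_le_pos _ _ L_nonneg G_nonneg). pose proof (Rmult_le_pos _ _ L_nonneg rr_nonneg).
  pose proof (Rmult_le_pos _ _ (pos_INR V) G_nonneg).
  pose proof (Rmult_le_pos _ _ (pos_INR V) rr_nonneg).
  apply Rmax_lub.
  - assert (gradient_le : norm n (gradient xb) <= center_grad K k + Lsum * r k).
    { eapply Rle_trans; [apply norm_le_via with (v := gradient (center K k))|].
      apply Rplus_le_compat_l, (gradients_near (fun _ => xb)).
      intros; apply xbar_near_center. }
    change (vsum V (fun i => g i xb)) with (gradient xb). rewrite <- norm_sqr.
    apply Rle_trans with (center_grad K k + Lsum * r k)².
    + pose proof (norm_nonneg n (gradient xb)). apply Rsqr_incr_1; lra.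
    + eapply Rle_trans; [apply sqr_add_le|]. rewrite Rsqr_mult. lra.
  - apply Rle_trans with (INR V * (r k)²); [|lra].
    rewrite <- rsum_const. apply rsum_le. intros i i_lt. rewrite <- norm_sqr.
    apply Rsqr_incr_1; auto using norm_nonneg. apply agent_near_xbar, i_lt.
Qed.

Lemma weighted_merit_le K k : gamma k <= 1 ->
  gamma k * merit n V g (sx (run k)) <= merit_constant * descent_rate K k.
Proof.
  intros gamma_le_1. pose proof (gamma_nonneg k).
  apply Rle_trans with (gamma k * (merit_constant * ((center_grad K k)² + (r k)²)));
    [apply Rmult_le_compat_l; [assumption | apply merit_le]|].
  pose proof merit_constant_pos.
  assert (0 <= merit_constant * ((1 - gamma k) * (r k)²))
    by (repeat apply Rmult_le_pos; try lra; apply r_nonneg).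
  unfold descent_rate. lra.
Qed.

Lemma weighted_merit_bounded_of_errors :
  exists C, forall K, rsum K (fun k => gamma k * merit n V g (sx (run k))) <= C.
Proof.
  destruct potential_decrease as (omega & mu & k0 & N & omega_nonneg & mu_pos & decrease).
  destruct (objective_center_bounded k0) as [upper objective_le].
  destruct (potential_bounded_below omega omega_nonneg) as [lower lower_le].
  set (term := fun k => gamma k * merit n V g (sx (run k))).
  pose proof merit_constant_pos.
  exists (rsum k0 term
          + merit_constant / mu * (upper + omega * (r k0)² + (q k0)² - lower)).
  apply rsum_bounded_by_potentials with (Phi := potential omega) (N := N); auto.
  - apply Rlt_le, Rdiv_lt_0_compat; assumption.
  - intros k. apply Rmult_le_pos; [apply gamma_nonneg|].
    eapply Rle_trans; [apply sqnorm_nonneg | apply Rmax_l].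
  - intros K k k_ge k_lt. destruct (decrease K k k_ge k_lt) as [gamma_le_1 potential_le].
    eapply Rle_trans; [apply (weighted_merit_le K), gamma_le_1|].
    replace (merit_constant * descent_rate K k)
      with (merit_constant / mu * (mu * descent_rate K k)) by (field; lra).
    apply Rmult_le_compat_l; [apply Rlt_le, Rdiv_lt_0_compat; assumption | lra].
  - intros K. unfold potential. specialize (objective_le K). lra.
Qed.

End ErrorBounds.

Lemma weighted_merit_bounded :
  exists C, forall K, rsum K (fun k => gamma k * merit n V g (sx (run k))) <= C.
Proof.
  destruct consensus_error as (rho_x & c_x & r & rho_x_range & r_nonneg & r_S & consensus_r).
  destruct tracking_error as (rho_z & c_z & q & rho_z_range & q_nonneg & q_S & tracking_q).
  apply (weighted_merit_bounded_of_errors rho_x c_x rho_z c_z r q); assumption.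
Qed.

End AsySonata.

(** * Step sizes and complexity *)

Lemma act_count_mono agent k s i : (act_count agent k i <= act_count agent (k + s) i)%nat.
Proof.
  induction s as [|s IH]; [rewrite Nat.add_0_r; lia|].
  rewrite Nat.add_succ_r. simpl. lia.
Qed.

Lemma act_count_ge V T agent : recurrent V T agent ->
  forall N k i, (i < V)%nat -> (N * T <= k)%nat -> (N <= act_count agent k i)%nat.
Proof.
  intros agent_recurrent N. induction N as [|N IH]; intros k i i_lt k_ge; [lia|].
  destruct (agent_recurrent (N * T)%nat i i_lt) as (t & t_range & t_active).
  specialize (IH t i i_lt ltac:(lia)).
  pose proof (act_count_mono agent (S t) (k - S t) i) as later.
  replace (S t + (k - S t))%nat with k in later by lia.
  simpl in later. rewrite t_active, Nat.eqb_refl in later. lia.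
Qed.

Lemma step_size_cv_0 V T agent alpha :
  (forall k, (agent k < V)%nat) -> recurrent V T agent ->
  Un_cv alpha 0 -> Un_cv (step_size alpha agent) 0.
Proof.
  intros agent_lt agent_recurrent alpha_cv eps eps_pos.
  destruct (alpha_cv eps eps_pos) as [N alpha_small].
  exists (N * T)%nat. intros k k_ge. apply alpha_small.
  apply (act_count_ge V T); [exact agent_recurrent | apply agent_lt | exact k_ge].
Qed.

Lemma complexity_of_bounded_sum (w m : nat -> R) :
  (forall k, 0 <= w k) -> (exists C, forall K, rsum K (fun k => w k * m k) <= C) ->
  exists c, 0 < c /\ forall delta, 0 < delta -> forall K, c / delta <= rsum (S K) w ->
    exists k, (k <= K)%nat /\ m k <= delta.
Proof.
  intros w_nonneg [C sum_le]. exists (Rabs C + 1).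
  split; [pose proof (Rabs_pos C); lra|]. intros delta delta_pos K sum_ge.
  apply NNPP. intros none.
  assert (m_large : forall k, (k <= K)%nat -> delta <= m k).
  { intros k k_le. apply Rnot_lt_le. intros m_small. apply none.
    exists k; split; [exact k_le | lra]. }
  assert (delta * rsum (S K) w <= rsum (S K) (fun k => w k * m k)).
  { rewrite <- rsum_scal. apply rsum_le. intros k k_lt. rewrite Rmult_comm.
    apply Rmult_le_compat_l; [apply w_nonneg | apply m_large; lia]. }
  apply Rmult_le_compat_l with (r := delta) in sum_ge; [|lra].
  replace (delta * ((Rabs C + 1) / delta)) with (Rabs C + 1) in sum_ge by (field; lra).
  specialize (sum_le (S K)). pose proof (Rle_abs C). lra.
Qed.

Theorem theorem4
  (n I : nat) (f : nat -> vec -> R) (g : nat -> vec -> vec) (L : nat -> R)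
  (E : nat -> nat -> bool) (W A : nat -> nat -> R) (mbar : R)
  (agent : nat -> nat) (d : nat -> nat -> nat) (T D : nat)
  (alpha : nat -> R) (x0 : nat -> vec)
  (* problem *)
  (HI : (0 < I)%nat)
  (Hgrad : forall i, (i < I)%nat -> is_gradient n (f i) (g i))
  (HLip : forall i, (i < I)%nat -> forall x y,
            norm n (vsub (g i x) (g i y)) <= L i * norm n (vsub x y))
  (Hbnd : exists lb, forall x, lb <= rsum I (fun i => f i x))
  (* graph *)
  (HEV : forall i j, E i j = true -> (i < I)%nat /\ (j < I)%nat)
  (HEloop : forall i, E i i = false)
  (HEconn : forall i j, (i < I)%nat -> (j < I)%nat ->
            clos_refl_trans nat (fun a b => E a b = true) i j)
  (* weights *)
  (Hm : 0 < mbar < 1)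
  (HWd : forall i, (i < I)%nat -> mbar <= W i i)
  (HWe : forall i j, (i < I)%nat -> (j < I)%nat -> E j i = true -> mbar <= W i j)
  (HW0 : forall i j, (i < I)%nat -> (j < I)%nat -> i <> j -> E j i = false -> W i j = 0)
  (HWrow : forall i, (i < I)%nat -> rsum I (fun j => W i j) = 1)
  (HAd : forall i, (i < I)%nat -> mbar <= A i i)
  (HAe : forall i j, (i < I)%nat -> (j < I)%nat -> E j i = true -> mbar <= A i j)
  (HA0 : forall i j, (i < I)%nat -> (j < I)%nat -> i <> j -> E j i = false -> A i j = 0)
  (HAcol : forall j, (j < I)%nat -> rsum I (fun i => A i j) = 1)
  (* asynchrony *)
  (Hagent : forall k, (agent k < I)%nat)
  (HT : forall k i, (i < I)%nat ->
        exists t, (k <= t < k + T)%nat /\ agent t = i)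
  (Hd : forall k j, E j (agent k) = true -> (d k j <= D)%nat)
  (* step sizes *)
  (Halpha_dec : forall t, alpha (S t) <= alpha t)
  (Halpha_lim : Un_cv alpha 0)
  (Halpha_div : forall M, exists N, M <= rsum N alpha) :
  let gamma := step_size alpha agent in
  let xk := fun k => sx (asy_run I E W A g agent d gamma D x0 k) in
  exists c, 0 < c /\
    forall delta, 0 < delta ->
      forall K, c / delta <= rsum (S K) gamma ->
        exists k, (k <= K)%nat /\ merit n I g (xk k) <= delta.
Proof.
  intros gamma xk.
  assert (gamma_nonneg : forall k, 0 <= gamma k)
    by (intros; apply (decreasing_ineq alpha 0); assumption).
  assert (graph : strongly_connected I E) by (constructor; assumption).
  assert (W_weights : weights I E mbar W) by (constructor; assumption).
  assert (A_weights : weights I E mbar A) by (constructor; assumption).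
  assert (gamma_cv_0 : Un_cv gamma 0) by (apply (step_size_cv_0 I T); assumption).
  apply complexity_of_bounded_sum; [exact gamma_nonneg|].
  apply (weighted_merit_bounded n I T D E W A mbar f g L agent d gamma x0); assumption.
Qed.
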